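(* In the setting described in the context, assume the problem is extremely ill-posed, i.e. $a_k\asymp e^{-pk^s}$ as $k\to\infty$ with $p>0$ and $s\ge1$, and let $\beta>0$. Take $\lambda_k=\rho_n^2k^{-1-2\alpha}$ with $\alpha>0$ and any positive sequence $\rho_n$ with $\rho_n^2n\to\infty$. Then for any $K>0$ and any $M_n\to\infty$, \[\sup_{f_0\in S^\beta:\|f_0\|_\beta\le K}\mathbb{E}_{f_0}\Pi_n\big(f:\|f-f_0\|_{H_1}\ge M_n\varepsilon_n\mid U^n\big)\to 0,\] where \[\varepsilon_n=\varepsilon_{n,1}\vee\varepsilon_{n,2}=(\log(\rho_n^2n))^{-\beta/s}\vee\rho_n(\log(\rho_n^2n))^{-\alpha/s}.\] In particular: (i) if $\rho_n=1$, then $\varepsilon_n=(\log n)^{-(\alpha\wedge\beta)/s}$; (ii) if $n^{-1/2+\delta}\lesssim\rho_n\lesssim(\log n)^{(\alpha-\beta)/s}$ for some $\delta>0$, then $\varepsilon_n=(\log n)^{-\beta/s}$. Furthermore, if instead $\lambda_k=\exp(-\alpha k^s)$ with $\alpha>0$, the same convergence holds with $\varepsilon_n=(\log n)^{-\beta/s}$.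
   Context: Let $H_1,H_2\subset L^2([0,1])$ be Hilbert spaces of functions on $[0,1]$ and $A:H_1\to H_2$ an injective compact linear operator. Let $\{\varphi_k\}_{k\ge1}$ be an orthonormal eigenbasis of $A^*A$ in $H_1$, $A^*A\varphi_k=a_k^2\varphi_k$ with $a_k>0$, and let $\psi_k:=A\varphi_k/a_k$ (an orthonormal system, $A\varphi_k=a_k\psi_k$). For $f\in H_1$ write $f_k=\langle f,\varphi_k\rangle$, identify $f$ with $(f_k)_k$, so $\|f\|_{H_1}^2=\sum_kf_k^2$. For $\beta\ge0$, $S^\beta$ is the set of $f=\sum_kf_k\varphi_k$ with $\|f\|_\beta:=(\sum_k f_k^2k^{2\beta})^{1/2}<\infty$. Observations: for $n\ge2$, design points $x_i=i/n$, and $Y_i=Af(x_i)+\xi_i$, $i=1,\dots,n$, with $\xi_i$ i.i.d. $\mathcal N(0,1)$ ($Af$ continuous). Put $\langle g,h\rangle_d:=\frac1n\sum_{i=1}^ng(x_i)h(x_i)$. Standing assumption on the conjugate basis: (i) $\langle\psi_j,\psi_k\rangle_d=\delta_{jk}$ for $1\le j,k\le n-1$; (ii) for $1\le k\le n-1$ and fixed $l\in\mathbb N$, among $j\in\{ln,\dots,(l+1)n-1\}$ there is exactly one $\tilde j=ln+\bar k$ ($\bar k$ depending only on the parity of $l$) with $0<|\langle\psi_{\tilde j},\psi_k\rangle_d|<M$ for a fixed constant $M$, and $\langle\psi_j,\psi_k\rangle_d=0$ for all other such $j$. Transformed data: $U_k:=\frac1n\sum_{i=1}^nY_i\psi_k(x_i)$,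 $k=1,\dots,n-1$, $U^n=(U_1,\dots,U_{n-1})$; thus $U_k=a_kf_k+R_k(f)+\zeta_k/\sqrt n$ with $R_k(f)=\langle A\sum_{j\ge n}f_j\varphi_j,\psi_k\rangle_d$ and $\zeta_k=n^{-1/2}\sum_{i=1}^n\xi_i\psi_k(x_i)$. $\mathbb E_{f_0}$ denotes expectation when the data are generated with $f=f_0$. Prior: $f_k\sim\mathcal N(0,\lambda_k)$ independently for $k<n$, $f_k=0$ for $k\ge n$, independent of the noise. The posterior is $\Pi_n(\cdot\mid U^n)=\bigotimes_{k\in\mathbb N}\mathcal N(\hat f_k,\sigma_k^2)$ (on coefficients) with $\hat f_k=\frac{na_k\lambda_k\mathbf 1\{k<n\}}{na_k^2\lambda_k+1}U_k$, $\sigma_k^2=\frac{\lambda_k\mathbf 1\{k<n\}}{na_k^2\lambda_k+1}$. Notation: $a\vee b=\max$, $a\wedge b=\min$; $a_n\lesssim b_n$ means $a_n\le Cb_n$ for a constant $C$; $a_n\asymp b_n$ means $a_n/b_n$ is bounded away from $0$ and $\infty$. *)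

(* Defs.v *)
From HB Require Import structures.
From mathcomp Require Import all_boot all_order all_algebra.
From mathcomp Require Import all_classical all_reals all_analysis.
Set Implicit Arguments. Unset Strict Implicit. Unset Printing Implicit Defensive.
Import Order.TTheory GRing.Theory Num.Theory.
Import numFieldNormedType.Exports.
Local Open Scope classical_set_scope.
Local Open Scope ring_scope.

Section Defs.
Context {R : realType}.

(* Coefficient sequences f = (f_k)_{k>=1} are functions nat -> R; the value at
   index 0 is ignored everywhere (all sums start at k = 1). *)

Definition h1sq (g : nat -> R) : \bar R :=
  (\sum_(1 <= k <oo) ((g k) ^+ 2)%:E)%E.

Definition h1norm (g : nat -> R) : R := Num.sqrt (fine (h1sq g)).

Definition sobsq (beta : R) (f : nat -> R) : \bar R :=
  (\sum_(1 <= k <oo) ((f k) ^+ 2 * (k%:R) `^ (2 * beta))%:E)%E.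

Definition sob_ball (beta K : R) : set (nat -> R) :=
  [set f | (sobsq beta f <= (K ^+ 2)%:E)%E].

Definition dip (n : nat) (g h : R -> R) : R :=
  (n%:R)^-1 * \sum_(1 <= i < n.+1) g (i%:R / n%:R) * h (i%:R / n%:R).

(* A f (x) = sum_{k>=1} a_k f_k psi_k(x)   (A phi_k = a_k psi_k) *)
Definition Aop (a : nat -> R) (psi : nat -> R -> R) (f : nat -> R) (x : R) : R :=
  limn (fun N => \sum_(1 <= k < N) a k * f k * psi k x).

(* iterated expectation of F over m i.i.d. N(0,1) variables z_0,...,z_{m-1}
   (the remaining coordinates are set to 0 and are irrelevant). *)
Fixpoint gexp (m : nat) (F : (nat -> R) -> \bar R) : \bar R :=
  match m with
  | 0 => F (fun _ => 0)
  | m'.+1 => (\int[normal_prob (0:R) 1]_x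
                gexp m' (fun z => F (fun i => if i == m' then x else z i)))%E
  end.

(* transformed data U_k given noise xi (xi_i = xi (i-1), i = 1..n) *)
Definition Uk (a : nat -> R) (psi : nat -> R -> R) (n : nat) (f0 : nat -> R)
  (xi : nat -> R) (k : nat) : R :=
  (n%:R)^-1 * \sum_(1 <= i < n.+1)
     (Aop a psi f0 (i%:R / n%:R) + xi i.-1) * psi k (i%:R / n%:R).

(* posterior mean and variance (prior f_k ~ N(0, lam k), k < n) *)
Definition post_mean (a : nat -> R) (psi : nat -> R -> R) (lam : nat -> R)
  (n : nat) (f0 xi : nat -> R) (k : nat) : R :=
  if (k < n)%N then
    n%:R * a k * lam k / (n%:R * a k ^+ 2 * lam k + 1) * Uk a psi n f0 xi k
  else 0.

Definition post_var (a : nat -> R) (lam : nat -> R) (n : nat) (k : nat) : R :=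
  if (k < n)%N then lam k / (n%:R * a k ^+ 2 * lam k + 1) else 0.

(* a draw from the posterior  (x)_k N(hat f_k, sigma_k^2), driven by
   standard normals w_0,...,w_{n-2} (f_k = hat f_k + sigma_k w_{k-1}) *)
Definition post_draw (a : nat -> R) (psi : nat -> R -> R) (lam : nat -> R)
  (n : nat) (f0 xi w : nat -> R) : nat -> R :=
  fun k => post_mean a psi lam n f0 xi k + Num.sqrt (post_var a lam n k) * w k.-1.

Definition post_prob (a : nat -> R) (psi : nat -> R -> R) (lam : nat -> R)
  (n : nat) (f0 : nat -> R) (r : R) (xi : nat -> R) : \bar R :=
  gexp n.-1 (fun w =>
    (\1_[set w | r <= h1norm (post_draw a psi lam n f0 xi w \- f0)] w)%:E).

Definition post_risk (a : nat -> R) (psi : nat -> R -> R) (lam : nat -> R)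
  (n : nat) (f0 : nat -> R) (r : R) : \bar R :=
  gexp n (post_prob a psi lam n f0 r).

Definition contracts (a : nat -> R) (psi : nat -> R -> R)
  (lam : nat -> nat -> R) (beta K : R) (eps : nat -> R) : Prop :=
  forall Mn : nat -> R, Mn @ \oo --> +oo ->
    (fun n => ereal_sup
        [set post_risk a psi (lam n) n f0 (Mn n * eps n) | f0 in sob_ball beta K])
      @ \oo --> 0%E.

Definition design_assumption (psi : nat -> R -> R) (Mpsi : R) : Prop :=
  forall n : nat, (2 <= n)%N ->
    (forall j k, (1 <= j < n)%N -> (1 <= k < n)%N ->
       dip n (psi j) (psi k) = (j == k)%:R) /\
    (forall k, (1 <= k < n)%N ->
       exists kbar : bool -> nat, (forall b, (kbar b < n)%N) /\
         forall l j, (1 <= l)%N -> (l * n <= j < l.+1 * n)%N ->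
           ((j = l * n + kbar (odd l))%N -> 0 < `|dip n (psi j) (psi k)| < Mpsi) /\
           ((j <> l * n + kbar (odd l))%N -> dip n (psi j) (psi k) = 0)).

End Defs.

(* Main.v *)
Require Import Defs.
From HB Require Import structures.
From mathcomp Require Import all_boot all_order all_algebra.
From mathcomp Require Import all_classical all_reals all_analysis.
From mathcomp Require Import measurable_realfun ring lra zify.
Import Order.TTheory GRing.Theory Num.Theory.
Import numFieldNormedType.Exports.
Local Open Scope classical_set_scope.
Local Open Scope ring_scope.

(** By Markov's inequality the posterior probability is at most [r ^- 2] times the mean
    squared error, and since the posterior draw is affine in the two Gaussian vectors, this
    error is an explicit sum of squared bias, sampling variance and posterior variance. Only
    monotonicity of the integral of nonnegative functions is used, so no measurability of the
    iterated integrands is needed.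

    For [s >= 1] the eigenvalues satisfy [a j <= C q^(j-k) a k] for [j >= k], with
    [q = exp(-p)]. Hence the aliasing residual of coefficient [k], divided by [a k], is at
    most [C' n^(-beta) q^(n-k)], and the remaining sums can be split at an arbitrary index
    [N]: the coefficients up to [N] cost at most [1 / (n (a N)^2)] in variance and
    [(n (a N)^2 lam N)^(-2)] in bias, while those above [N] cost the prior mass and
    [N^(-2 beta)]. Taking [N^s] proportional to the logarithm of the effective sample size,
    with a constant small enough that the exponential terms are a negative power of that
    sample size, yields the stated rates. *)

Set Implicit Arguments. Unset Strict Implicit. Unset Printing Implicit Defensive.

(** * Gaussian expectations *)

Section normal_moments.
Context {R : realType}.
Local Notation mu := (@lebesgue_measure R).
Local Notation P := (normal_prob (0:R) 1).
Local Open Scope ereal_scope.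

(** The Radon-Nikodym derivative of [P] and [normal_pdf] have the same integral over every
    measurable set, so they agree almost everywhere and may be exchanged under the integral. *)
Lemma ge0_integral_normal_prob (f : R -> R) : (forall x, (0 <= f x)%R) ->
  measurable_fun [set: R] f ->
  \int[P]_x (f x)%:E = \int[mu]_x (f x * normal_pdf 0 1 x)%:E.
Proof.
move=> f0 mf.
have dom := @normal_prob_dominates R 0 1.
have mE : measurable_fun [set: R] (EFin \o f) by exact/measurable_EFinP.
rewrite -(@Radon_Nikodym_SigmaFinite.change_of_variables _ _ _ P mu dom (EFin \o f))//.
apply: ae_eq_integral => //.
- apply: emeasurable_funM => //; apply: (measurable_int mu).
  exact: Radon_Nikodym_SigmaFinite.f_integrable.
- apply/measurable_EFinP/measurable_funM => //; exact: measurable_normal_pdf.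
- under [X in ae_eq _ _ _ X]eq_fun do rewrite EFinM.
  apply: ae_eqe_mul2l => /=.
  apply: integral_ae_eq => //=.
  + exact: Radon_Nikodym_SigmaFinite.f_integrable.
  + by apply/measurableT_comp =>//; exact: measurable_normal_pdf.
  + by move=> E _ mE'; rewrite -Radon_Nikodym_SigmaFinite.f_integral.
Qed.

(** Since [1 + u <= expR u] at [u = x ^+ 2 / 4], half of the Gaussian exponent absorbs the factor
    [x ^+ 2]; what remains is a multiple of the density of variance 2. This gives finiteness of the
    second moment without evaluating it. *)
Lemma sqr_normal_pdf_le (x : R) :
  (x ^+ 2 * normal_pdf 0 1 x <=
   4 * normal_peak 1 / normal_peak (Num.sqrt 2) * normal_pdf 0 (Num.sqrt 2) x)%R.
Proof.
have s2 : (Num.sqrt 2 != 0 :> R)%R by rewrite sqrtr_eq0 -ltNge.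
rewrite !normal_pdfE ?oner_neq0// /normal_fun subr0.
have pk : (0 < normal_peak (1:R))%R by rewrite normal_peak_gt0// oner_neq0.
have pk2 : (0 < normal_peak (Num.sqrt 2 : R))%R by rewrite normal_peak_gt0.
rewrite sqr_sqrtr// [leRHS]mulrA divfK ?gt_eqF//.
rewrite mulrCA [leRHS]mulrAC [leRHS]mulrC ler_pM2l//.
have -> : (- x ^+ 2 / (1 ^+ 2 *+ 2) = - x ^+ 2 / (2 *+ 2) + - (x ^+ 2 / 4))%R by field.
rewrite expRD mulrCA [leRHS]mulrC ler_pM2l ?expR_gt0//.
rewrite expRN ler_pdivrMr ?expR_gt0//.
have := expR_ge1Dx (x ^+ 2 / 4); lra.
Qed.

Lemma normal_integrable_sqr : P.-integrable [set: R] (fun x => (x ^+ 2)%:E).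
Proof.
have m2 : measurable_fun [set: R] (fun x : R => (x ^+ 2)%R) by exact: measurable_funX.
apply/integrableP; split; first exact/measurable_EFinP.
under eq_integral do rewrite /= ger0_norm ?sqr_ge0//.
rewrite ge0_integral_normal_prob//; last by move=> x; exact: sqr_ge0.
set c : R := (4 * normal_peak 1 / normal_peak (Num.sqrt 2))%R.
apply: (@le_lt_trans _ _ (\int[mu]_x (c * normal_pdf 0 (Num.sqrt 2) x)%:E)).
  apply: ge0_le_integral => //=.
  - by move=> x _; rewrite lee_fin mulr_ge0 ?sqr_ge0 ?normal_pdf_ge0.
  - apply/measurable_EFinP/measurable_funM => //; exact: measurable_normal_pdf.
  - apply/measurable_EFinP/measurable_funM => //; exact: measurable_normal_pdf.
  - by move=> x _; rewrite lee_fin; exact: sqr_normal_pdf_le.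
under eq_integral do rewrite EFinM.
rewrite integralZl//; last exact: integrable_normal_pdf.
by rewrite integral_normal_pdf mule1 ltry.
Qed.

Lemma normal_integrable_id : P.-integrable [set: R] (fun x => x%:E).
Proof.
have i1 : P.-integrable [set: R] (fun x => (1 + x ^+ 2)%:E).
  under eq_fun do rewrite EFinD.
  apply: integrableD => //; last exact: normal_integrable_sqr.
  exact: finite_measure_integrable_cst.
apply: (le_integrable _ _ _ i1) => //; first exact/measurable_EFinP.
move=> x _; rewrite lee_fin [leRHS]ger0_norm ?addr_ge0 ?sqr_ge0//.
have := sqr_ge0 (`|x| - 1)%R; rewrite -(real_normK (num_real x)).
have := normr_ge0 x; nra.
Qed.

Lemma ge0_integral_fold (f : R -> R) : (forall x, (0 <= f x)%R) -> continuous f ->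
  \int[mu]_x (f x)%:E = \int[mu]_(x in `[0%R, +oo[) (f x)%:E +
    \int[mu]_(x in `[0%R, +oo[) (f (- x))%:E.
Proof.
move=> f0 cf.
have mf : measurable_fun [set: R] f by exact: continuous_measurable_fun.
have mposnums : measurable (`[0%R, +oo[%classic : set R) by [].
rewrite -(setUv (`[0%R, +oo[%classic : set R)) ge0_integral_setU//=; last 4 first.
  exact: measurableC.
  by apply/measurable_EFinP; rewrite setUv.
  by move=> x _; rewrite lee_fin.
  exact/disj_setPCl.
congr +%E; rewrite setCitvr.
rewrite integral_itv_bndo_bndc; last exact/measurable_EFinP/measurable_funTS.
rewrite -{1}oppr0 ge0_integration_by_substitutionNy//.
exact: continuous_subspaceT.
Qed.

Lemma ge0_integral_comp_opp (f : R -> R) : (forall x, (0 <= f x)%R) ->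
  continuous f -> \int[mu]_x (f (- x))%:E = \int[mu]_x (f x)%:E.
Proof.
move=> f0 cf; rewrite ge0_integral_fold//; last first.
  by move=> x; apply: continuous_comp; [exact: opp_continuous|exact: cf].
rewrite [RHS]ge0_integral_fold// addeC.
by under eq_integral do rewrite opprK.
Qed.

(** The density is even, so reflection turns the integral of the positive part into that of the
    negative part; both are finite and cancel. *)
Lemma normal_mean0 : \int[P]_x x%:E = 0.
Proof.
have pfin := integrable_pos_fin_num measurableT normal_integrable_id.
rewrite integralE; suff -> : \int[P]_x (EFin^\- x) = \int[P]_x (EFin^\+ x) :> \bar R.
  exact: subee.
pose f (x : R) := (Num.max x 0 * normal_pdf 0 1 x)%R.
have maxc : continuous (fun x : R => Num.max x 0)%R.
  by move=> x; apply: continuous_max; [exact: cvg_id | exact: cvg_cst].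
transitivity (\int[mu]_x (f x)%:E); last first.
  rewrite -ge0_integral_normal_prob//.
  - by apply: eq_integral => x _; rewrite funeposE -EFin_max.
  - by move=> x; rewrite le_max lexx orbT.
  - exact: continuous_measurable_fun.
rewrite -ge0_integral_comp_opp; last 2 first.
  - by move=> x; rewrite mulr_ge0 ?normal_pdf_ge0// le_max lexx orbT.
  - by move=> x; apply: cvgM; [exact: maxc | exact/continuous_normal_pdf/oner_neq0].
transitivity (\int[mu]_x (Num.max (- x) 0 * normal_pdf 0 1 x)%:E); last first.
  apply: eq_integral => x _; rewrite /f !normal_pdfE ?oner_neq0//.
  by rewrite /normal_fun !subr0 sqrrN.
rewrite -ge0_integral_normal_prob//.
- by apply: eq_integral => x _; rewrite funenegE -EFinN -EFin_max.
- by move=> x; rewrite le_max lexx orbT.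
- apply: measurable_maxr => //; exact: measurableT_comp.
Qed.

(** The second moment is left unevaluated, because it enters only the constants of the rates. *)
Definition normal_var : R := fine (\int[P]_x (x ^+ 2)%:E).

Lemma normal_var_ge0 : (0 <= normal_var)%R.
Proof. by apply: fine_ge0; apply: integral_ge0 => x _; rewrite lee_fin sqr_ge0. Qed.

Lemma normal_integral_quad (a b c : R) :
  \int[P]_x (a + b * x + c * x ^+ 2)%:E = (a + c * normal_var)%:E.
Proof.
have i0 : P.-integrable [set: R] (EFin \o (fun=> a)).
  exact: finite_measure_integrable_cst.
have i1 : P.-integrable [set: R] (EFin \o (fun x => b * x)%R).
  exact: (integrableZl measurableT b normal_integrable_id).
have i2 : P.-integrable [set: R] (EFin \o (fun x => c * x ^+ 2)%R).
  exact: (integrableZl measurableT c normal_integrable_sqr).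
have i01 : P.-integrable [set: R] (EFin \o (fun x => a + b * x)%R).
  exact: (integrableD measurableT i0 i1).
transitivity (\int[P]_x ((EFin \o (fun x => a + b * x)%R) \+ (EFin \o (fun x => c * x ^+ 2)%R)) x) => //.
rewrite integralD_EFin//.
transitivity (\int[P]_x ((EFin \o (fun=> a)) \+ (EFin \o (fun x => b * x)%R)) x +
  \int[P]_x (c%:E * (x ^+ 2)%:E)) => //.
rewrite integralD_EFin// integral_cst// [X in _ * X]probability_setT mule1.
transitivity (a%:E + \int[P]_x (b%:E * x%:E) + \int[P]_x (c%:E * (x ^+ 2)%:E)) => //.
rewrite (integralZl measurableT normal_integrable_id) (integralZl measurableT normal_integrable_sqr).
rewrite normal_mean0 mule0 adde0 /normal_var EFinD EFinM fineK//.
exact: (integrable_fin_num measurableT normal_integrable_sqr).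
Qed.

(** The integral of a nonnegative function is a supremum over the nonnegative simple functions below
    it, and a larger function has more of these. *)
Lemma ge0_le_integral_nomeas d (T : measurableType d) (nu : {measure set T -> \bar R})
    (f g : T -> \bar R) : (forall x, 0 <= f x) -> (forall x, f x <= g x) ->
  \int[nu]_x f x <= \int[nu]_x g x.
Proof.
move=> f0 fg; rewrite !ge0_integralTE//; last by move=> x; exact: le_trans (fg x).
apply: ge_ereal_sup => _ [h /= hf <-]; apply: ereal_sup_ubound; exists h => //.
by move=> x; exact: le_trans (fg x).
Qed.

End normal_moments.

(** * Iterated Gaussian expectations of sums of squares *)

Section gauss_expectation.
Context {R : realType}.
Local Notation v := (@normal_var R).
Implicit Types (F G : (nat -> R) -> \bar R).

Lemma gexp_ge0 m F : (forall z, 0 <= F z)%E -> (0 <= gexp m F)%E.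
Proof.
by elim: m F => [|m IH] F F0 //=; apply: integral_ge0 => x _; exact: IH.
Qed.

Lemma le_gexp m F G : (forall z, 0 <= F z)%E -> (forall z, F z <= G z)%E ->
  (gexp m F <= gexp m G)%E.
Proof.
elim: m F G => [|m IH] F G F0 FG //=.
by apply: ge0_le_integral_nomeas => x; [exact: gexp_ge0|exact: IH].
Qed.

(** Induction on the number of variables: for a fixed value [x] of the outermost one, the shift
    becomes [b k + c k m * x]. The induction hypothesis then leaves a quadratic polynomial in [x],
    whose linear term integrates to zero. *)
Lemma gexp_sum_sqr (I : Type) (r : seq I) m (d : R) (b : I -> R) (c : I -> nat -> R) :
  gexp m (fun z => (d + \sum_(k <- r) (b k + \sum_(i < m) c k i * z i) ^+ 2)%:E) =
  (d + \sum_(k <- r) (b k ^+ 2 + v * \sum_(i < m) c k i ^+ 2))%:E.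
Proof.
elim: m b => [|m IH] b /=.
  congr (_ + _)%:E; apply: eq_bigr => k _.
  by rewrite !big_ord0 mulr0 !addr0.
transitivity (\int[normal_prob (0:R) 1]_x
   (d + \sum_(k <- r) ((b k + c k m * x) ^+ 2 + v * \sum_(i < m) c k i ^+ 2))%:E)%E.
  apply: eq_integral => x _; rewrite -(IH (fun k => b k + c k m * x)).
  congr gexp; apply/funext => z; congr (_ + _)%:E; apply: eq_bigr => k _.
  rewrite big_ord_recr/= eqxx [X in b k + X]addrC addrA; congr ((_ + _) ^+ 2).
  by apply: eq_bigr => i _; rewrite ltn_eqF.
transitivity (\int[normal_prob (0:R) 1]_x
   ((d + \sum_(k <- r) (b k ^+ 2 + v * \sum_(i < m) c k i ^+ 2)) +
    (\sum_(k <- r) (2 * b k * c k m)) * x + (\sum_(k <- r) c k m ^+ 2) * x ^+ 2)%:E)%E.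
  apply: eq_integral => x _; congr EFin.
  rewrite !mulr_suml -!addrA -!big_split/=; congr (_ + _); apply: eq_bigr => k _.
  by ring.
rewrite normal_integral_quad; congr EFin.
rewrite -addrA mulr_suml -big_split/=; congr (_ + _); apply: eq_bigr => k _.
by rewrite big_ord_recr/=; ring.
Qed.

End gauss_expectation.

(** * Posterior risk and mean squared error *)

Section risk_bound.
Context {R : realType}.
Local Notation v := (@normal_var R).
Implicit Types (a lam f : nat -> R) (psi : nat -> R -> R).

Definition shrink a lam n k : R :=
  n%:R * a k * lam k / (n%:R * a k ^+ 2 * lam k + 1).

Definition tailsq n f : \bar R := (\sum_(n <= k <oo) ((f k) ^+ 2)%:E)%E.

Lemma gexp_scaled_sum_sqr (I : Type) (r : seq I) m (e d : R) (b : I -> R)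
    (c : I -> nat -> R) :
  gexp m (fun z =>
    (e ^+ 2 * (d + \sum_(k <- r) (b k + \sum_(i < m) c k i * z i) ^+ 2))%:E) =
  (e ^+ 2 * (d + \sum_(k <- r) (b k ^+ 2 + v * \sum_(i < m) c k i ^+ 2)))%:E.
Proof.
transitivity (gexp m (fun z => (e ^+ 2 * d +
    \sum_(k <- r) (e * b k + \sum_(i < m) (e * c k i) * z i) ^+ 2)%:E)).
  congr gexp; apply/funext => z; congr EFin; rewrite mulrDr mulr_sumr; congr +%R.
  apply: eq_bigr => k _; rewrite -exprMn mulrDr mulr_sumr; congr ((_ + _) ^+ 2).
  by apply: eq_bigr => i _; rewrite mulrA.
rewrite (gexp_sum_sqr _ _ _ (fun k => e * b k) (fun k i => e * c k i)).
congr EFin; rewrite mulrDr mulr_sumr; congr +%R.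
apply: eq_bigr => k _; rewrite mulrDr exprMn mulrCA !mulr_sumr; congr +%R.
by apply: eq_bigr => i _; rewrite exprMn mulrCA.
Qed.

Lemma sum_pick_ord m j (x : R) (z : nat -> R) : (j < m)%N ->
  \sum_(i < m) (if i == j :> nat then x else 0) * z i = x * z j.
Proof.
move=> jm; rewrite (bigD1 (Ordinal jm))//= eqxx big1 ?addr0// => i.
by rewrite -val_eqE/= => /negbTE ->; rewrite mul0r.
Qed.

Lemma sum_pick_ord_sqr m j (x : R) : (j < m)%N ->
  \sum_(i < m) (if i == j :> nat then x else 0) ^+ 2 = x ^+ 2.
Proof.
move=> jm; rewrite (bigD1 (Ordinal jm))//= eqxx big1 ?addr0// => i.
by rewrite -val_eqE/= => /negbTE ->; rewrite expr0n.
Qed.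

Lemma UkE a psi n f xi k :
  Uk a psi n f xi k = dip n (Aop a psi f) (psi k) +
    \sum_(i < n) (n%:R^-1 * psi k (i.+1%:R / n%:R)) * xi i.
Proof.
rewrite /Uk /dip -(big_mkord xpredT (fun i => n%:R^-1 * psi k (i.+1%:R / n%:R) * xi i)).
rewrite !big_add1/=.
under [X in _ = _ + X]eq_bigr do rewrite -mulrA.
rewrite -mulr_sumr -mulrDr -big_split/=; congr *%R.
by apply: eq_bigr => i _; rewrite mulrDl [psi _ _ * _]mulrC.
Qed.

Lemma post_varE a lam n k : (k < n)%N ->
  post_var a lam n k = lam k / (n%:R * a k ^+ 2 * lam k + 1).
Proof. by rewrite /post_var => ->. Qed.

Lemma h1sq_draw a psi lam n f xi w : (1 <= n)%N -> tailsq n f \is a fin_num ->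
  h1sq (post_draw a psi lam n f xi w \- f) =
  (fine (tailsq n f) + \sum_(1 <= k < n)
    (post_mean a psi lam n f xi k - f k + Num.sqrt (post_var a lam n k) * w k.-1) ^+ 2)%:E.
Proof.
move=> n1 tfin; rewrite /h1sq (nneseries_split 1 n.-1); last first.
  by move=> k _; rewrite lee_fin sqr_ge0.
rewrite add1n prednK// addeC EFinD; congr adde.
  rewrite fineK//; apply/congr_lim/funext => m; apply: eq_big_nat => k /andP[nk _]; congr EFin.
  by rewrite /= /post_draw /post_mean /post_var ltnNge nk/= sqrtr0 mul0r addr0 sub0r sqrrN.
rewrite -sumEFin; apply: eq_bigr => k _; congr (_ ^+ 2)%:E.
by rewrite /post_draw/= addrAC.
Qed.

(** Markov's inequality under the posterior: the indicator is at most [r^-1 ^+ 2] times the squared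
    distance. Coefficients from [n] on are zero under the posterior and contribute the tail of
    [f]. *)
Lemma post_prob_le a psi lam n f (r : R) xi : (1 <= n)%N -> 0 < r ->
  (forall k, (1 <= k < n)%N -> 0 <= post_var a lam n k) ->
  tailsq n f \is a fin_num ->
  (post_prob a psi lam n f r xi <= (r^-1 ^+ 2 * (fine (tailsq n f) +
     \sum_(1 <= k < n) ((post_mean a psi lam n f xi k - f k) ^+ 2
       + v * post_var a lam n k)))%:E)%E.
Proof.
(* The coefficient matrix has one entry per row, at column [k.-1], because coefficient [k] is driven
   by [w k.-1]. *)
move=> n1 r0 vge tfin; pose sd k i := if i == k.-1 then Num.sqrt (post_var a lam n k) else 0.
pose b k := post_mean a psi lam n f xi k - f k.
have -> : (r^-1 ^+ 2 * (fine (tailsq n f) +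
    \sum_(1 <= k < n) (b k ^+ 2 + v * post_var a lam n k)))%:E =
    gexp n.-1 (fun w => (r^-1 ^+ 2 * (fine (tailsq n f) +
      \sum_(1 <= k < n) (b k + \sum_(i < n.-1) sd k i * w i) ^+ 2))%:E).
  rewrite gexp_scaled_sum_sqr; congr (_ * (_ + _))%:E.
  apply: eq_big_nat => k /andP[k1 kn]; rewrite /sd sum_pick_ord_sqr.
    by rewrite sqr_sqrtr// vge// k1.
  by rewrite -ltnS !prednK.
apply: le_gexp => w; rewrite lee_fin indicE ?ler0n//.
have [rw|_] := boolP (w \in _); last first.
  rewrite mulr_ge0 ?sqr_ge0// addr_ge0 ?sumr_ge0// => [|k _]; last exact: sqr_ge0.
  by apply: fine_ge0; apply: nneseries_ge0 => k _ _; rewrite lee_fin sqr_ge0.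
rewrite inE /= in rw; rewrite exprVn ler_pdivlMl ?exprn_gt0// mulr1.
have : r ^+ 2 <= h1norm (post_draw a psi lam n f xi w \- f) ^+ 2.
  by rewrite ler_sqr ?nnegrE ?sqrtr_ge0 ?(ltW r0).
rewrite /h1norm h1sq_draw//= sqr_sqrtr; last first.
  rewrite addr_ge0 ?sumr_ge0// => [|k _]; last exact: sqr_ge0.
  by apply: fine_ge0; apply: nneseries_ge0 => k _ _; rewrite lee_fin sqr_ge0.
congr (_ <= _ + _); apply: eq_big_nat => k /andP[k1 kn].
by rewrite /sd sum_pick_ord// -ltnS !prednK.
Qed.

(** The same computation, now over the observation noise. Discrete normalisation of [psi k] reduces
    the noise variance of [U_k] to [v / n], which the posterior mean multiplies by the squared
    shrinkage factor. *)
Lemma post_risk_le a psi lam n f (r : R) : (1 <= n)%N -> 0 < r ->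
  (forall k, (1 <= k < n)%N -> 0 <= post_var a lam n k) ->
  (forall k, (1 <= k < n)%N -> dip n (psi k) (psi k) = 1) ->
  tailsq n f \is a fin_num ->
  (post_risk a psi lam n f r <= (r^-1 ^+ 2 * (fine (tailsq n f) +
     \sum_(1 <= k < n)
       ((shrink a lam n k * dip n (Aop a psi f) (psi k) - f k) ^+ 2
        + v * (shrink a lam n k ^+ 2 / n%:R) + v * post_var a lam n k)))%:E)%E.
Proof.
move=> n1 r0 vge dip1 tfin.
pose c k i := shrink a lam n k * (n%:R^-1 * psi k (i.+1%:R / n%:R)).
pose b k := shrink a lam n k * dip n (Aop a psi f) (psi k) - f k.
(* The posterior variance does not depend on the data, so it joins the deterministic part. *)
pose d := fine (tailsq n f) + \sum_(1 <= k < n) v * post_var a lam n k.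
have -> : (r^-1 ^+ 2 * (fine (tailsq n f) + \sum_(1 <= k < n)
       (b k ^+ 2 + v * (shrink a lam n k ^+ 2 / n%:R) + v * post_var a lam n k)))%:E =
    gexp n (fun xi => (r^-1 ^+ 2 * (d +
      \sum_(1 <= k < n) (b k + \sum_(i < n) c k i * xi i) ^+ 2))%:E).
  rewrite gexp_scaled_sum_sqr /d -addrA -big_split/=; congr (_ * (_ + _))%:E.
  apply: eq_big_nat => k kn; rewrite [LHS]addrC; congr (_ + (_ + _)); congr *%R.
  rewrite /c; under eq_bigr do rewrite [(shrink _ _ _ _ * _) ^+ 2]exprMn [X in _ * X]exprMn.
  rewrite -mulr_sumr -mulr_sumr; congr *%R.
  have := dip1 _ kn; rewrite /dip big_add1/= big_mkord => nd.
  under eq_bigr do rewrite expr2.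
  by rewrite expr2 -mulrA nd mulr1.
apply: le_gexp => xi; first exact: gexp_ge0.
apply: le_trans (post_prob_le _ _ n1 r0 vge tfin) _; rewrite lee_fin.
rewrite ler_pM2l ?exprn_gt0 ?invr_gt0// /d -addrA lerD2l -big_split/=.
rewrite le_eqVlt; apply/orP; left; apply/eqP; apply: eq_big_nat => k /andP[k1 kn].
rewrite addrC /post_mean kn UkE mulrDr mulr_sumr addrAC.
by congr ((_ + _) ^+ 2 + _); apply: eq_bigr => i _; rewrite mulrA.
Qed.

End risk_bound.

(** * Bounds on the mean squared error *)

Section geometric_sums.
Context {R : realType}.
Implicit Types (q x y s : R) (g f : nat -> R).

Lemma sum_geometric_below q n N : 0 <= q < 1 ->
  \sum_(1 <= k < n) (if (k <= N)%N then q ^+ (N - k) else 0) <= (1 - q)^-1.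
Proof.
move=> /andP[q0 q1]; have q1' : 0 < 1 - q by rewrite subr_gt0.
(* The extra factor [q ^+ (N - m)] makes the induction close, since [q / (1 - q) + 1 = 1 / (1 - q)].
   Truncated subtraction turns it into 1 once [m] reaches [N]. *)
suff H m : \sum_(1 <= k < m.+1) (if (k <= N)%N then q ^+ (N - k) else 0) <=
    (1 - q)^-1 * q ^+ (N - m).
  case: n => [|n]; first by rewrite big_geq// invr_ge0 ltW.
  apply: le_trans (H n) _; rewrite ler_piMr ?invr_ge0 ?(ltW q1')//.
  by rewrite exprn_ile1// ltW.
elim: m => [|m IH]; first by rewrite big_geq// mulr_ge0 ?invr_ge0 ?(ltW q1') ?exprn_ge0.
rewrite big_nat_recr//=; have [mN|mN] := leqP m.+1 N; last first.
  rewrite addr0; apply: le_trans IH _.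
  by rewrite (eqP (ltnW mN : N - m.+1 == 0)%N) (eqP (mN : N - m == 0)%N).
apply: le_trans (lerD IH (lexx _)) _.
rewrite -[(N - m)%N](subnSK mN) exprS -(ler_pM2l q1') mulrDr !mulVKf ?gt_eqF//.
by rewrite mulrBl mul1r addrCA subrr addr0.
Qed.

Lemma sum_geometric_above q n N : 0 <= q < 1 ->
  \sum_(n <= j < N) q ^+ (j - n) <= (1 - q)^-1.
Proof.
move=> /andP[q0 q1]; have q1' : 0 < 1 - q by rewrite subr_gt0.
have [Nn|nN] := leqP N n; first by rewrite big_geq// invr_ge0 ltW.
rewrite -[N](subnKC (ltnW nN)); move: (N - n)%N => m.
suff : (1 - q) * \sum_(n <= j < n + m) q ^+ (j - n) = 1 - q ^+ m.
  move=> H; rewrite -(ler_pM2l q1') H divff ?gt_eqF// gerBl exprn_ge0//.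
elim: m => [|m IH]; first by rewrite addn0 big_geq// mulr0 subrr.
by rewrite addnS big_nat_recr ?leq_addr//= mulrDr IH addKn exprS; ring.
Qed.

Lemma sum_if_gt g n N :
  \sum_(1 <= k < n) (if (N < k)%N then g k else 0) = \sum_(N.+1 <= k < n) g k.
Proof.
by rewrite -big_mkcond (big_nat_widenl N.+1 1).
Qed.

(** Writing [z]^ s = z * z [^ (s - 1)], the second factor is at least 1 and nondecreasing. This is
    where [s >= 1] turns the exponents [k^s] into at least linear growth, hence geometric decay of
    the eigenvalues. *)
Lemma powR_ge_add s x y : 1 <= s -> 1 <= y -> y <= x -> y `^ s + (x - y) <= x `^ s.
Proof.
move=> s1 y1 yx; have y0 : 0 < y by exact: lt_le_trans y1.
have x0 : 0 < x by exact: lt_le_trans yx.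
have e z : 0 < z -> z `^ s = z * z `^ (s - 1).
  by move=> z0; rewrite mulr_powRB1 ?(ltW z0)// (lt_le_trans _ s1).
have h : y `^ (s - 1) <= x `^ (s - 1).
  by rewrite ge0_ler_powR ?subr_ge0// nnegrE ltW.
have h1 : 1 <= y `^ (s - 1).
  by rewrite -[X in X <= _](powRr0 y) ler_powR// subr_ge0.
rewrite !e//; nra.
Qed.

Lemma powR_nat_ge_add s k j : 1 <= s -> (1 <= k <= j)%N ->
  k%:R `^ s + (j - k)%:R <= j%:R `^ s.
Proof.
move=> s1 /andP[k1 kj]; rewrite natrB//; apply: powR_ge_add => //; last by rewrite ler_nat.
by rewrite ler1n.
Qed.

Lemma pos_bounded_prefix g m : (forall k, (1 <= k)%N -> 0 < g k) ->
  exists2 C, 0 < C & forall k, (1 <= k < m)%N -> g k <= C.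
Proof.
move=> g0; elim: m => [|m [C C0 IH]]; first by exists 1 => // k; rewrite andbF.
exists (Num.max C (g m)) => [|k /andP[k1]]; first by rewrite lt_max C0.
rewrite ltnS leq_eqVlt => /orP[/eqP ->|km]; rewrite le_max ?lexx ?orbT//.
by rewrite IH ?k1.
Qed.

End geometric_sums.

(** * Comparison of eigenvalues *)

Section spectrum.
Context {R : realType}.
Implicit Types (a : nat -> R) (p s : R).

(** Only finitely many indices lie below [k0]; the maxima of the ratio and of its inverse over them
    are merged into the constants. *)
Lemma asymp_uniform a p s : (forall k, (1 <= k)%N -> 0 < a k) ->
  (exists c1 c2 : R, 0 < c1 /\ 0 < c2 /\
     exists k0 : nat, forall k : nat, (k0 <= k)%N ->
       c1 * expR (- p * k%:R `^ s) <= a k <= c2 * expR (- p * k%:R `^ s)) ->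
  exists c1 c2 : R, [/\ 0 < c1, 0 < c2 & forall k, (1 <= k)%N ->
       c1 * expR (- p * k%:R `^ s) <= a k <= c2 * expR (- p * k%:R `^ s)].
Proof.
move=> a0 [c1 [c2 [c10 [c20 [k0 ak]]]]]; pose e k := expR (- p * k%:R `^ s).
have e0 k : 0 < e k by exact: expR_gt0.
have [C1 C10 HC1] := @pos_bounded_prefix R (fun k => a k / e k) k0
  (fun k k1 => divr_gt0 (a0 k k1) (e0 k)).
have [C2 C20 HC2] := @pos_bounded_prefix R (fun k => e k / a k) k0
  (fun k k1 => divr_gt0 (e0 k) (a0 k k1)).
exists (Num.min c1 C2^-1), (Num.max c2 C1); split.
- by rewrite lt_min c10 invr_gt0.
- by rewrite lt_max c20.
move=> k k1; rewrite -!/(e k); have [kk0|k0k] := leqP k0 k.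
  have /andP[h1 h2] := ak _ kk0; apply/andP; split.
    by apply: le_trans h1; rewrite ler_pM2r ?e0 ?ge_min ?lexx.
  by apply: le_trans h2 _; rewrite ler_pM2r ?e0 ?le_max ?lexx.
have := HC1 k; have := HC2 k; rewrite k1 k0k => /(_ isT) h2 /(_ isT) h1.
apply/andP; split.
  apply: (@le_trans _ _ (C2^-1 * e k)); first by rewrite ler_pM2r ?e0 ?ge_min ?lexx ?orbT.
  by rewrite ler_pdivrMl// -ler_pdivrMr// a0.
apply: (@le_trans _ _ (C1 * e k)); first by rewrite -ler_pdivrMr.
by rewrite ler_pM2r ?e0 ?le_max ?lexx ?orbT.
Qed.

(** The quotient of the two bounds is [c2 / c1] times [exp(-p (j^s - k^s))], and
    [j^s - k^s >= j - k]. *)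
Lemma asymp_ratio a p s c1 c2 : 0 <= p -> 1 <= s -> 0 < c1 -> 0 < c2 ->
  (forall k, (1 <= k)%N ->
     c1 * expR (- p * k%:R `^ s) <= a k <= c2 * expR (- p * k%:R `^ s)) ->
  forall k j, (1 <= k <= j)%N -> a j <= c2 / c1 * expR (- p) ^+ (j - k) * a k.
Proof.
move=> p0 s1 c10 c20 ak k j /andP[k1 kj].
have /andP[h1 _] := ak _ k1.
have /andP[_ h2] := ak _ (leq_trans k1 kj).
apply: le_trans h2 _.
apply: (@le_trans _ _ (c2 * (expR (- p) ^+ (j - k) * expR (- p * k%:R `^ s)))).
  rewrite ler_pM2l// -expRM_natl -expRD ler_expR.
  have := @powR_nat_ge_add R s k j s1; rewrite k1 kj => /(_ isT) h.
  rewrite mulrN mulNr mulNr -opprD lerN2 mulrC -mulrDr ler_wpM2l//.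
  by rewrite addrC.
rewrite -!mulrA ler_pM2l// mulrCA ler_pM2l ?exprn_gt0 ?expR_gt0//.
by rewrite ler_pdivlMl.
Qed.

End spectrum.

(** * Tails of sequences in a Sobolev ball *)

Section sobolev.
Context {R : realType}.
Variables (beta K : R).
Hypotheses (beta0 : 0 <= beta) (K0 : 0 <= K).
Implicit Types f : nat -> R.

Lemma sob_ball_finite f : sob_ball beta K f -> (sobsq beta f < +oo)%E.
Proof. by move=> bf; apply: le_lt_trans bf _; exact: ltry. Qed.

Lemma sob_ball_partial f m : sob_ball beta K f ->
  \sum_(1 <= k < m) f k ^+ 2 * k%:R `^ (2 * beta) <= K ^+ 2.
Proof.
move=> bf; rewrite -lee_fin -sumEFin; apply: le_trans bf.
by apply: nneseries_lim_ge => k _ _; rewrite lee_fin mulr_ge0 ?sqr_ge0 ?powR_ge0.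
Qed.

Lemma sob_ball_sum f N m : (1 <= N)%N -> sob_ball beta K f ->
  \sum_(N <= k < m) f k ^+ 2 <= K ^+ 2 * N%:R `^ (- (2 * beta)).
Proof.
move=> N1 bf; have [mN|Nm] := leqP m N.
  by rewrite big_geq// mulr_ge0 ?sqr_ge0 ?powR_ge0.
have NR : 0 < N%:R :> R by rewrite ltr0n.
rewrite powRN ler_pdivlMr ?powR_gt0// mulr_suml.
apply: le_trans (sob_ball_partial m bf).
rewrite [leRHS](@big_cat_nat _ _ _ N)//= ?(ltnW Nm)//.
apply: (@le_trans _ _ (\sum_(N <= k < m) f k ^+ 2 * k%:R `^ (2 * beta))).
  rewrite !big_nat ler_sum// => k /andP[Nk _].
  rewrite ler_wpM2l ?sqr_ge0// ge0_ler_powR ?mulr_ge0// ?nnegrE ?ler0n//.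
  by rewrite ler_nat.
by rewrite lerDr sumr_ge0// => k _; rewrite mulr_ge0 ?sqr_ge0 ?powR_ge0.
Qed.

(** One squared coefficient is at most the tail sum that contains it. *)
Lemma sob_ball_coef f n j : (1 <= n <= j)%N -> sob_ball beta K f ->
  `|f j| <= K * n%:R `^ (- beta).
Proof.
move=> /andP[n1 nj] bf.
rewrite -ler_sqr ?nnegrE ?mulr_ge0 ?powR_ge0// real_normK ?num_real// exprMn.
rewrite -(powR_mulrn _ (powR_ge0 _ _)) -powRrM.
have -> : - beta * 2%:R = - (2 * beta) by rewrite mulNr mulrC.
apply: le_trans (sob_ball_sum j.+1 n1 bf); rewrite big_nat_recr//=.
by rewrite lerDr sumr_ge0// => k _; rewrite sqr_ge0.
Qed.

Lemma sob_ball_tailsq f n : (1 <= n)%N -> sob_ball beta K f ->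
  (tailsq n f <= (K ^+ 2 * n%:R `^ (- (2 * beta)))%:E)%E.
Proof.
move=> n1 bf; apply: lime_le.
  by apply: is_cvg_nneseries => k _ _; rewrite lee_fin sqr_ge0.
by apply: nearW => m; rewrite sumEFin lee_fin sob_ball_sum.
Qed.

Lemma tailsq_ge0 f n : (0 <= tailsq n f)%E.
Proof. by apply: nneseries_ge0 => k _ _; rewrite lee_fin sqr_ge0. Qed.

Lemma sob_ball_tailsq_fin f n : (1 <= n)%N -> sob_ball beta K f ->
  tailsq n f \is a fin_num.
Proof.
move=> n1 bf; rewrite ge0_fin_numE ?tailsq_ge0//.
exact: le_lt_trans (sob_ball_tailsq n1 bf) (ltry _).
Qed.

Lemma sob_ball0 : sob_ball beta K (fun=> 0).
Proof.
rewrite /sob_ball /sobsq /= eseries0 ?lee_fin ?sqr_ge0// => k _ _.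
by rewrite expr0n mul0r.
Qed.

End sobolev.

(** * The aliasing residual *)

Section residual.
Context {R : realType}.
Variables (a : nat -> R) (psi : nat -> R -> R) (Mpsi beta K C q : R).
Hypotheses (a_pos : forall k, (1 <= k)%N -> 0 < a k)
  (design : design_assumption psi Mpsi) (beta0 : 0 <= beta) (K0 : 0 <= K)
  (C0 : 0 < C) (q01 : 0 <= q < 1)
  (ratio : forall k j, (1 <= k <= j)%N -> a j <= C * q ^+ (j - k) * a k)
  (A_def : forall f : nat -> R, (sobsq beta f < +oo)%E ->
     forall x : R, 0 <= x <= 1 ->
       cvgn (fun N => \sum_(1 <= k < N) a k * f k * psi k x)).

Lemma cvg_sum_fin (I : Type) (r : seq I) (F : I -> nat -> R) (l : I -> R)
    (P : pred I) : (forall i, P i -> F i @ \oo --> l i) ->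
  (fun n => \sum_(i <- r | P i) F i n) @ \oo --> \sum_(i <- r | P i) l i.
Proof.
move=> Fl; elim: r => [|i r IH].
  by rewrite big_nil; under eq_fun do rewrite big_nil; exact: cvg_cst.
rewrite big_cons; under eq_fun do rewrite big_cons.
by case: ifPn => // Pi; apply: cvgD => //; exact: Fl.
Qed.

Lemma dipE n g h : dip n g h =
  n%:R^-1 * \sum_(i < n) g (i.+1%:R / n%:R) * h (i.+1%:R / n%:R) :> R.
Proof. by rewrite /dip big_add1/= big_mkord. Qed.

(** The discrete inner product is a finite sum over design points, so pointwise convergence of the
    series for [A f] suffices to exchange it with the limit. *)
Lemma cvg_dip_Aop n k f : (1 <= n)%N -> sob_ball beta K f ->
  (fun N => \sum_(1 <= j < N) a j * f j * dip n (psi j) (psi k)) @ \oo -->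
  dip n (Aop a psi f) (psi k).
Proof.
move=> n1 bf.
have -> : (fun N => \sum_(1 <= j < N) a j * f j * dip n (psi j) (psi k)) =
    (fun N => n%:R^-1 * \sum_(i < n)
      (\sum_(1 <= j < N) a j * f j * psi j (i.+1%:R / n%:R)) * psi k (i.+1%:R / n%:R)).
  apply/funext => N; under eq_bigr do rewrite dipE mulrCA.
  rewrite -mulr_sumr; congr *%R; under eq_bigr do rewrite mulr_sumr.
  rewrite exchange_big/=; apply: eq_bigr => i _.
  by rewrite mulr_suml; apply: eq_bigr => j _; rewrite mulrA.
rewrite dipE; apply: cvgM; first exact: cvg_cst.
apply: cvg_sum_fin => i _; apply: cvgM; last exact: cvg_cst.
apply: A_def; first exact: sob_ball_finite bf.
rewrite divr_ge0// ler_pdivrMr ?ltr0n// mul1r ler_nat.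
exact: ltn_ord.
Qed.

Lemma dip_partial n k N f : (2 <= n)%N -> (1 <= k < n)%N -> (n <= N)%N ->
  \sum_(1 <= j < N) a j * f j * dip n (psi j) (psi k) =
  a k * f k + \sum_(n <= j < N) a j * f j * dip n (psi j) (psi k).
Proof.
move=> n2 kn nN; have [orth _] := design n2.
rewrite (@big_cat_nat _ _ _ n)//= ?(ltnW n2)//; congr +%R.
rewrite (bigD1_seq k) ?mem_index_iota ?iota_uniq//= orth// eqxx mulr1.
rewrite big_seq_cond big1 ?addr0// => j; rewrite mem_index_iota => /andP[jn jk].
by rewrite orth// (negbTE jk) mulr0.
Qed.

(** The index [j] lies in block [l = j %/ n], which is at least 1. The absolute value around [Mpsi]
    also covers the vanishing inner products. *)
Lemma dip_high_le n k j : (2 <= n)%N -> (1 <= k < n)%N -> (n <= j)%N ->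
  `|dip n (psi j) (psi k)| <= `|Mpsi|.
Proof.
move=> n2 kn nj; have [_ /(_ _ kn)[kbar [_ high]]] := design n2.
have n0 : (0 < n)%N by exact: ltnW.
have l1 : (1 <= j %/ n)%N by rewrite divn_gt0.
have jl : (j %/ n * n <= j < (j %/ n).+1 * n)%N by rewrite leq_trunc_div ltn_ceil.
have [h1 h2] := high _ _ l1 jl.
have [/h1/andP[_ /ltW h]|/eqP/h2 ->] := eqVneq j (j %/ n * n + kbar (odd (j %/ n)))%N.
  exact: le_trans h (ler_norm _).
by rewrite normr0.
Qed.

Definition residual_const := `|Mpsi| * K * C / (1 - q).

Lemma residual_const_ge0 : 0 <= residual_const.
Proof.
have /andP[q0 q1] := q01.
by rewrite divr_ge0 ?subr_ge0 ?(ltW q1)// !mulr_ge0// ltW.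
Qed.

(* The factor [q ^+ (n - k)] keeps the aliasing error summable in [k] after division by [a k]. *)
Lemma residual_le n k f : (2 <= n)%N -> (1 <= k < n)%N -> sob_ball beta K f ->
  `|dip n (Aop a psi f) (psi k) - a k * f k| <=
  residual_const * n%:R `^ (- beta) * q ^+ (n - k) * a k.
Proof.
move=> n2 kn bf; have /andP[k1 kn'] := kn; have /andP[q0 q1] := q01.
have n1 : (1 <= n)%N by exact: ltnW.
apply: (@cvgr_to_le _ \oo _ _
  (fun N => `|\sum_(1 <= j < N) a j * f j * dip n (psi j) (psi k) - a k * f k|)).
  by apply: cvg_norm; apply: cvgB; [exact: cvg_dip_Aop | exact: cvg_cst].
exists n => // N /= nN; rewrite dip_partial// addrC addKr.
apply: le_trans (ler_norm_sum _ _ _) _.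
apply: (@le_trans _ _ (\sum_(n <= j < N) (C * q ^+ (n - k) * a k *
    (K * n%:R `^ (- beta)) * `|Mpsi|) * q ^+ (j - n))).
  rewrite !big_nat ler_sum// => j /andP[nj _].
  have kj : (k <= j)%N by exact: leq_trans (ltnW kn') nj.
  have j1 : (1 <= j)%N by exact: leq_trans kj.
  rewrite 2!normrM (gtr0_norm (a_pos j1)) [leRHS]mulrAC.
  rewrite ler_pM ?mulr_ge0 ?(ltW (a_pos j1)) ?dip_high_le//.
  rewrite [leRHS]mulrAC ler_pM ?(ltW (a_pos j1))//; last by rewrite sob_ball_coef// n1.
  have kkj : (1 <= k <= j)%N by rewrite k1.
  apply: le_trans (ratio kkj) _.
  (* Passing through [n] splits the decay into a factor fixed by [k] and one that is summed over
     [j]. *)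
  have -> : (j - k = (n - k) + (j - n))%N by lia.
  by rewrite exprD mulrA mulrAC.
rewrite -mulr_sumr.
apply: (@le_trans _ _ (C * q ^+ (n - k) * a k * (K * n%:R `^ (- beta)) * `|Mpsi| * (1 - q)^-1)).
  rewrite ler_wpM2l ?sum_geometric_above// !mulr_ge0 ?exprn_ge0 ?powR_ge0 ?(ltW C0)//.
  exact/ltW/a_pos.
by rewrite le_eqVlt; apply/orP; left; apply/eqP; rewrite /residual_const; ring.
Qed.

End residual.

(** * Bias and variance bounds *)

Section mse.
Context {R : realType}.
Local Notation v := (@normal_var R).

(** With [c] the shrinkage factor and [u = n * A ^+ 2 * l], the error is [t * y - z], where
    [t = c * A] lies in [0,1], [y] is the residual divided by [A], and [z = f / (u + 1)] is the bias
    of shrinkage alone. *)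
Lemma shrink_bias_le (n A l x f : R) : 0 < n -> 0 < A -> 0 < l ->
  (n * A * l / (n * A ^+ 2 * l + 1) * x - f) ^+ 2 <=
  2 * ((x - A * f) / A) ^+ 2 + 2 * (f / (n * A ^+ 2 * l + 1)) ^+ 2.
Proof.
move=> n0 A0 l0; set u := n * A ^+ 2 * l.
have u0 : 0 < u by rewrite !mulr_gt0// exprn_gt0.
set c := n * A * l / (u + 1).
have u1 : u + 1 != 0 by rewrite gt_eqF// addr_gt0.
have cA : c * A = 1 - (u + 1)^-1.
  by rewrite /c; move: u1; rewrite /u => u1; field.
have cA1 : 0 <= c * A <= 1.
  rewrite cA subr_ge0 invf_le1 ?addr_gt0// lerDr (ltW u0)/= gerBl invr_ge0.
  by rewrite ltW// addr_gt0.
set y := (x - A * f) / A; set z := f / (u + 1).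
have -> : c * x - f = (c * A) * y - z.
  have -> : z = f * (1 - c * A) by rewrite cA opprB addrCA subrr addr0.
  by rewrite /y; field; rewrite gt_eqF.
have /andP[h1 h2] := cA1; move: (c * A) h1 h2 => t h1 h2.
have ty : (t * y) ^+ 2 <= y ^+ 2.
  by rewrite exprMn ler_piMl ?sqr_ge0// exprn_ile1.
have := sqr_ge0 (t * y + z); nra.
Qed.

(** The left side is the posterior variance times [u / (u + 1)] with [u = n * A ^+ 2 * l], so
    sampling variance needs no separate bound. *)
Lemma shrink_sqr_le (n A l : R) : 0 < n -> 0 < A -> 0 < l ->
  (n * A * l / (n * A ^+ 2 * l + 1)) ^+ 2 / n <= l / (n * A ^+ 2 * l + 1).
Proof.
move=> n0 A0 l0; have u0 : 0 < n * A ^+ 2 * l by rewrite !mulr_gt0// exprn_gt0.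
have u1 : n * A ^+ 2 * l + 1 != 0 by rewrite gt_eqF// addr_gt0.
have -> : (n * A * l / (n * A ^+ 2 * l + 1)) ^+ 2 / n =
    l / (n * A ^+ 2 * l + 1) * (1 - (n * A ^+ 2 * l + 1)^-1).
  by field; rewrite u1 gt_eqF.
rewrite ler_piMr ?divr_ge0 ?addr_ge0 ?(ltW u0) ?(ltW l0)//.
by rewrite gerBl invr_ge0 addr_ge0 ?(ltW u0).
Qed.

Lemma ler_sum5 (k1 k2 k3 k4 k5 x1 x2 x3 x4 x5 : R) :
  0 <= k1 -> 0 <= k2 -> 0 <= k3 -> 0 <= k4 -> 0 <= k5 ->
  0 <= x1 -> 0 <= x2 -> 0 <= x3 -> 0 <= x4 -> 0 <= x5 ->
  k1 * x1 + k2 * x2 + k3 * x3 + k4 * x4 + k5 * x5 <=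
  (k1 + k2 + k3 + k4 + k5) * (x1 + x2 + x3 + x4 + x5).
Proof.
move=> k10 k20 k30 k40 k50 x10 x20 x30 x40 x50; rewrite !mulrDr.
by rewrite !lerD// ler_wpM2r//; lra.
Qed.

Variables (a : nat -> R) (psi : nat -> R -> R) (Mpsi beta K C q : R).
Hypotheses (a_pos : forall k, (1 <= k)%N -> 0 < a k)
  (design : design_assumption psi Mpsi) (beta0 : 0 <= beta) (K0 : 0 <= K)
  (C0 : 0 < C) (q01 : 0 <= q < 1)
  (ratio : forall k j, (1 <= k <= j)%N -> a j <= C * q ^+ (j - k) * a k)
  (A_def : forall f : nat -> R, (sobsq beta f < +oo)%E ->
     forall x : R, 0 <= x <= 1 ->
       cvgn (fun N => \sum_(1 <= k < N) a k * f k * psi k x)).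
Local Notation D := (residual_const Mpsi K C q).

Section fixed_prior.
Variables (lam : nat -> R).
Hypotheses (lam_pos : forall k, (1 <= k)%N -> 0 < lam k)
  (lam_dec : forall k j, (1 <= k <= j)%N -> lam j <= lam k).

(** For [k <= N], [a N <= C * a k] and the monotonicity of [lam] bound the quantity [n a_k^2 lam_k]
    below by its value at [N] divided by [C ^+ 2]; squaring gives [C ^+ 4]. For [k > N] the
    shrinkage denominator is at least 1 and the Sobolev tail remains. *)
Lemma bias_sum_le n N f : (2 <= n)%N -> (1 <= N)%N -> sob_ball beta K f ->
  \sum_(1 <= k < n) (f k / (n%:R * a k ^+ 2 * lam k + 1)) ^+ 2 <=
  C ^+ 4 * K ^+ 2 * ((n%:R * a N ^+ 2 * lam N) ^- 2) + K ^+ 2 * N%:R `^ (- (2 * beta)).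
Proof.
move=> n2 N1 bf; have nR : 0 < n%:R :> R by rewrite ltr0n ltnW.
set w := (n%:R * a N ^+ 2 * lam N) ^- 2.
have uN : 0 < n%:R * a N ^+ 2 * lam N.
  by rewrite !mulr_gt0 ?exprn_gt0 ?a_pos ?lam_pos.
have Cw0 : 0 <= C ^+ 4 * w.
  by rewrite mulr_ge0 ?invr_ge0 ?exprn_ge0 ?(ltW C0) ?(ltW uN).
apply: (@le_trans _ _ (\sum_(1 <= k < n) (C ^+ 4 * w * f k ^+ 2 +
    if (N < k)%N then f k ^+ 2 else 0))).
  rewrite !big_nat ler_sum// => k /andP[k1 _].
  have ak := a_pos k1; have lk := lam_pos k1.
  have u0 : 0 < n%:R * a k ^+ 2 * lam k by rewrite !mulr_gt0// exprn_gt0.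
  rewrite exprMn [leLHS]mulrC; case: leqP => kN; last first.
    rewrite -[leLHS]add0r lerD ?(mulr_ge0 Cw0 (sqr_ge0 _))//.
    rewrite ler_piMl ?sqr_ge0// exprn_ile1 ?invr_ge0 ?addr_ge0 ?(ltW u0)//.
    by rewrite invf_le1 ?addr_gt0// lerDr ltW.
  rewrite addr0 ler_wpM2r ?sqr_ge0//.
  have kNN : (1 <= k <= N)%N by rewrite k1.
  have aNk : a N <= C * a k.
    apply: le_trans (ratio kNN) _; rewrite ler_pM2r// ler_piMr ?(ltW C0)//.
    by have /andP[q0 /ltW q1] := q01; rewrite exprn_ile1.
  have h : n%:R * a N ^+ 2 * lam N <= C ^+ 2 * (n%:R * a k ^+ 2 * lam k).
    have -> : C ^+ 2 * (n%:R * a k ^+ 2 * lam k) = n%:R * (C ^+ 2 * a k ^+ 2 * lam k) by ring.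
    rewrite -[leLHS]mulrA ler_pM2l// ler_pM//.
    + by rewrite exprn_ge0// ltW// a_pos.
    + by rewrite ltW// lam_pos.
    + by rewrite -exprMn lerXn2r ?nnegrE ?mulr_ge0 ?(ltW C0) ?(ltW ak) ?(ltW (a_pos N1)).
    + exact: lam_dec.
  set u := n%:R * a k ^+ 2 * lam k in u0 h *.
  have up : 0 < u + 1 by rewrite addr_gt0.
  have -> : C ^+ 4 * w = ((n%:R * a N ^+ 2 * lam N) / C ^+ 2) ^- 2.
    by rewrite expr_div_n invf_div -exprM.
  rewrite exprVn lef_pV2 ?posrE ?exprn_gt0 ?divr_gt0 ?exprn_gt0//.
  rewrite lerXn2r ?nnegrE ?(ltW up) ?divr_ge0 ?(ltW uN) ?exprn_ge0 ?(ltW C0)//.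
  by rewrite ler_pdivrMr ?exprn_gt0// [leRHS]mulrC (le_trans h)// ler_pM2l ?exprn_gt0// lerDl.
rewrite big_split/= -mulr_sumr sum_if_gt lerD//.
  rewrite mulrAC ler_wpM2r ?invr_ge0 ?exprn_ge0 ?(ltW uN)//.
  rewrite ler_wpM2l ?exprn_ge0 ?(ltW C0)//.
  by have := @sob_ball_sum R beta K beta0 f 1 n isT bf; rewrite powR1 mulr1.
apply: le_trans (sob_ball_sum beta0 n (ltn0Sn N) bf) _.
rewrite ler_wpM2l ?sqr_ge0// !powRN lef_pV2 ?posrE ?powR_gt0 ?ltr0n//.
by rewrite ge0_ler_powR ?mulr_ge0// ?nnegrE ?ler0n// ler_nat.
Qed.

(** Up to [N] the summand is at most [1 / (n a_k^2)], which decays geometrically as [k] moves down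
    from [N], so the last term dominates. Above [N] it is at most the prior variance. *)
Lemma var_sum_le n N : (2 <= n)%N -> (1 <= N)%N ->
  \sum_(1 <= k < n) lam k / (n%:R * a k ^+ 2 * lam k + 1) <=
  C ^+ 2 / (1 - q) * (n%:R * a N ^+ 2)^-1 + \sum_(N.+1 <= k < n) lam k.
Proof.
move=> n2 N1; have nR : 0 < n%:R :> R by rewrite ltr0n ltnW.
have /andP[q0 q1] := q01; have aN := a_pos N1.
apply: (@le_trans _ _ (\sum_(1 <= k < n)
    (C ^+ 2 / (n%:R * a N ^+ 2) * (if (k <= N)%N then q ^+ (N - k) else 0) +
    if (N < k)%N then lam k else 0))).
  rewrite !big_nat ler_sum// => k /andP[k1 _].
  have ak := a_pos k1; have lk := lam_pos k1.
  have u0 : 0 < n%:R * a k ^+ 2 * lam k by rewrite !mulr_gt0// exprn_gt0.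
  case: leqP => kN; last first.
    rewrite mulr0 add0r ler_piMr ?(ltW lk)//.
    by rewrite invf_le1 ?addr_gt0// lerDr ltW.
  rewrite addr0.
  have kNN : (1 <= k <= N)%N by rewrite k1.
  have aNk : a N ^+ 2 <= C ^+ 2 * q ^+ (N - k) * a k ^+ 2.
    apply: (@le_trans _ _ ((C * q ^+ (N - k) * a k) ^+ 2)).
      by rewrite lerXn2r ?nnegrE ?ratio ?(ltW aN)// (le_trans (ltW aN))// ratio.
    rewrite !exprMn ler_pM2r ?exprn_gt0// ler_pM2l ?exprn_gt0//.
    by rewrite expr2 ler_piMr ?exprn_ge0// exprn_ile1// ltW.
  apply: (@le_trans _ _ (n%:R * a k ^+ 2)^-1).
    rewrite ler_pdivrMr ?addr_gt0// mulrDr mulr1 mulrA mulVf ?mul1r ?lerDl ?invr_ge0.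
      by rewrite mulr_ge0 ?exprn_ge0// ltW.
    by rewrite mulf_neq0 ?expf_neq0 ?gt_eqF.
  have -> : C ^+ 2 / (n%:R * a N ^+ 2) * q ^+ (N - k) =
      n%:R^-1 * (C ^+ 2 * q ^+ (N - k) / a N ^+ 2).
    by field; rewrite !gt_eqF.
  rewrite invfM ler_pM2l ?invr_gt0// ler_pdivlMr ?exprn_gt0// mulrC.
  by rewrite ler_pdivrMr ?exprn_gt0.
rewrite big_split/= sum_if_gt lerD2r -mulr_sumr.
rewrite [leRHS]mulrAC ler_wpM2l ?sum_geometric_below//.
by rewrite divr_ge0 ?mulr_ge0 ?exprn_ge0 ?(ltW C0) ?(ltW aN).
Qed.

Lemma mse_le n N f : (2 <= n)%N -> (1 <= N)%N -> sob_ball beta K f ->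
  fine (tailsq n f) + \sum_(1 <= k < n)
     ((shrink a lam n k * dip n (Aop a psi f) (psi k) - f k) ^+ 2
        + v * (shrink a lam n k ^+ 2 / n%:R) + v * post_var a lam n k) <=
  (2 * v * (C ^+ 2 / (1 - q)) + 2 * v + 2 * (C ^+ 4 * K ^+ 2) + 2 * K ^+ 2 +
    (K ^+ 2 + 2 * D ^+ 2 / (1 - q))) *
  ((n%:R * a N ^+ 2)^-1 + \sum_(N.+1 <= k < n) lam k +
   (n%:R * a N ^+ 2 * lam N) ^- 2 + N%:R `^ (- (2 * beta)) + n%:R `^ (- (2 * beta))).
Proof.
move=> n2 N1 bf; have nR : 0 < n%:R :> R by rewrite ltr0n ltnW.
have /andP[q0 q1] := q01; have aN := a_pos N1; have v0 := @normal_var_ge0 R.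
have q1' : 0 <= (1 - q)^-1 by rewrite invr_ge0 subr_ge0 ltW.
have n1 : (1 <= n)%N by exact: ltnW.
have D0 : 0 <= D by exact: residual_const_ge0.
apply: le_trans (ler_sum5 _ _ _ _ _ _ _ _ _ _); last first.
- exact: powR_ge0.
- exact: powR_ge0.
- by rewrite invr_ge0 sqr_ge0.
- by rewrite big_nat sumr_ge0// => k /andP[Nk _]; rewrite ltW// lam_pos// (leq_trans _ Nk).
- by rewrite invr_ge0 mulr_ge0 ?exprn_ge0// ltW.
- by rewrite addr_ge0 ?sqr_ge0// mulr_ge0// mulr_ge0// sqr_ge0.
- by rewrite mulr_ge0// sqr_ge0.
- by rewrite mulr_ge0// mulr_ge0 ?sqr_ge0// exprn_ge0// ltW.
- by rewrite mulr_ge0.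
- by rewrite mulr_ge0 ?mulr_ge0 ?sqr_ge0 ?exprn_ge0 ?(ltW C0).
have ht : fine (tailsq n f) <= K ^+ 2 * n%:R `^ (- (2 * beta)).
  rewrite -lee_fin fineK ?(sob_ball_tailsq_fin beta0 n1 bf)//.
  exact: (sob_ball_tailsq beta0 n1 bf).
have hb := bias_sum_le n2 N1 bf; have hv := var_sum_le n2 N1.
(* Termwise: twice the squared residual, where one of the two factors [q ^+ (n - k)] is dropped,
   twice the squared shrinkage bias, and [2 * v] for sampling and posterior variance together. *)
have hs : \sum_(1 <= k < n)
     ((shrink a lam n k * dip n (Aop a psi f) (psi k) - f k) ^+ 2
        + v * (shrink a lam n k ^+ 2 / n%:R) + v * post_var a lam n k) <=
  \sum_(1 <= k < n) (2 * D ^+ 2 * n%:R `^ (- (2 * beta)) *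
       (if (k <= n)%N then q ^+ (n - k) else 0)
     + 2 * (f k / (n%:R * a k ^+ 2 * lam k + 1)) ^+ 2
     + 2 * v * (lam k / (n%:R * a k ^+ 2 * lam k + 1))).
  rewrite !big_nat ler_sum// => k /[dup] kn /andP[k1 kn'].
  have ak := a_pos k1; have lk := lam_pos k1.
  rewrite (ltnW kn') post_varE//.
  have h1 := shrink_bias_le (dip n (Aop a psi f) (psi k)) (f k) nR ak lk.
  have h2 := ler_wpM2l v0 (shrink_sqr_le nR ak lk).
  have h3 : ((dip n (Aop a psi f) (psi k) - a k * f k) / a k) ^+ 2 <=
      D ^+ 2 * n%:R `^ (- (2 * beta)) * q ^+ (n - k).
    rewrite -(real_normK (num_real (_ / _))).
    apply: (@le_trans _ _ ((D * n%:R `^ (- beta) * q ^+ (n - k)) ^+ 2)).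
      have B0 : 0 <= D * n%:R `^ (- beta) * q ^+ (n - k).
        by rewrite mulr_ge0 ?exprn_ge0// mulr_ge0 ?powR_ge0.
      rewrite lerXn2r ?nnegrE ?normr_ge0//.
      rewrite normrM normfV (gtr0_norm ak) ler_pdivrMr//.
      exact: (residual_le a_pos design beta0 K0 C0 q01 ratio A_def n2 kn bf).
    have -> : (D * n%:R `^ (- beta) * q ^+ (n - k)) ^+ 2 =
        D ^+ 2 * n%:R `^ (- (2 * beta)) * (q ^+ (n - k)) ^+ 2.
      rewrite 2!exprMn; congr (_ * _ * _); rewrite -(powR_mulrn _ (powR_ge0 _ _)) -powRrM.
      by have -> : - beta * 2%:R = - (2 * beta) by rewrite mulNr mulrC.
    rewrite ler_wpM2l ?(mulr_ge0 (sqr_ge0 _) (powR_ge0 _ _))//.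
    by rewrite expr2 ler_piMr ?exprn_ge0// exprn_ile1// ltW.
  rewrite /shrink; lra.
have hg := @sum_geometric_below R q n n q01.
have hg' : 2 * D ^+ 2 * n%:R `^ (- (2 * beta)) *
    (\sum_(1 <= k < n) (if (k <= n)%N then q ^+ (n - k) else 0)) <=
    2 * D ^+ 2 / (1 - q) * n%:R `^ (- (2 * beta)).
  by rewrite mulrAC ler_wpM2r ?powR_ge0// ler_wpM2l// mulr_ge0 ?sqr_ge0.
have hv' := ler_wpM2l (mulr_ge0 (ler0n R 2) v0) hv.
apply: le_trans (lerD ht hs) _; rewrite !big_split/= -!mulr_sumr.
lra.
Qed.

End fixed_prior.
End mse.

(** * From mean squared error to contraction *)

Section contraction_criterion.
Context {R : realType}.
Variables (a : nat -> R) (psi : nat -> R -> R) (Mpsi beta K C q : R).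
Hypotheses (a_pos : forall k, (1 <= k)%N -> 0 < a k)
  (design : design_assumption psi Mpsi) (beta0 : 0 <= beta) (K0 : 0 <= K)
  (C0 : 0 < C) (q01 : 0 <= q < 1)
  (ratio : forall k j, (1 <= k <= j)%N -> a j <= C * q ^+ (j - k) * a k)
  (A_def : forall f : nat -> R, (sobsq beta f < +oo)%E ->
     forall x : R, 0 <= x <= 1 ->
       cvgn (fun N => \sum_(1 <= k < N) a k * f k * psi k x)).

(** In order: variance up to [N], prior mass above [N], shrinkage bias up to [N], Sobolev tail above
    [N], and truncation with aliasing at [n]. *)
Definition mse_rate (lam : nat -> R) (n N : nat) : R :=
  (n%:R * a N ^+ 2)^-1 + \sum_(N.+1 <= k < n) lam k +
   (n%:R * a N ^+ 2 * lam N) ^- 2 + N%:R `^ (- (2 * beta)) + n%:R `^ (- (2 * beta)).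

(** At radius [Mn n * eps n] the factor [eps n ^+ 2] cancels, leaving a multiple of
    [(Mn n)^-1 ^+ 2], uniformly over the ball. The split index [N] may depend on [n]. *)
Lemma contracts_of_mse_rate (lam : nat -> nat -> R) (eps : nat -> R) (B : R) :
  (forall n k, (1 <= k)%N -> 0 < lam n k) ->
  (forall n k j, (1 <= k <= j)%N -> lam n j <= lam n k) ->
  (\forall n \near \oo, 0 < eps n) ->
  (\forall n \near \oo, exists2 N, (1 <= N)%N & mse_rate (lam n) n N <= B * eps n ^+ 2) ->
  contracts a psi lam beta K eps.
Proof.
move=> lam_pos lam_dec eps0 rateB Mn Mnoo.
pose c0 : R := 2 * normal_var * (C ^+ 2 / (1 - q)) + 2 * normal_var +
  2 * (C ^+ 4 * K ^+ 2) + 2 * K ^+ 2 +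
    (K ^+ 2 + 2 * residual_const Mpsi K C q ^+ 2 / (1 - q)).
have c00 : 0 <= c0.
  have /andP[q0 q1] := q01; have v0 := @normal_var_ge0 R.
  have q1' : 0 <= (1 - q)^-1 by rewrite invr_ge0 subr_ge0 ltW.
  have K2 := sqr_ge0 K; have C4 : 0 <= C ^+ 4 by rewrite exprn_ge0// ltW.
  have h1 := mulr_ge0 (sqr_ge0 (residual_const Mpsi K C q)) q1'.
  have h2 := mulr_ge0 v0 (mulr_ge0 (sqr_ge0 C) q1').
  have h3 := mulr_ge0 C4 K2.
  rewrite /c0; lra.
apply: (@squeeze_cvge _ _ _ _ (cst 0%E) _ (fun n => (c0 * B * (Mn n)^-1 ^+ 2)%:E)).
- near=> n.
  have n2 : (2 <= n)%N by near: n; exists 2%N.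
  have e0 : 0 < eps n by near: n.
  have M1 : 0 < Mn n by near: n; exact: (cvgry_gt Mnoo).
  have [N N1 rn] : exists2 N, (1 <= N)%N & mse_rate (lam n) n N <= B * eps n ^+ 2 by near: n.
  have nR : 0 < n%:R :> R by rewrite ltr0n ltnW.
  apply/andP; split.
    (* The zero sequence lies in the ball, so the supremum dominates a nonnegative risk. *)
    apply: le_trans (ereal_sup_ubound _); last first.
      by exists (fun=> 0) => //; exact: sob_ball0.
    apply: gexp_ge0 => xi; apply: gexp_ge0 => w.
    by rewrite lee_fin indicE.
  apply: ge_ereal_sup => _ [f bf <-].
  apply: (le_trans (@post_risk_le R a psi (lam n) n f _ (ltnW n2) (mulr_gt0 M1 e0) _ _ _)).
  - move=> k /andP[k1 kn]; rewrite post_varE// divr_ge0 ?(ltW (lam_pos _ _ k1))//.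
    rewrite addr_ge0// mulr_ge0 ?(ltW (lam_pos _ _ k1))//.
    by rewrite mulr_ge0 ?sqr_ge0.
  - by move=> k kn; have [-> //] := design n2; rewrite eqxx.
  - exact: (sob_ball_tailsq_fin beta0 (ltnW n2) bf).
  rewrite lee_fin.
  have h := mse_le a_pos design beta0 K0 C0 q01 ratio A_def (lam_pos n) (lam_dec n) n2 N1 bf.
  rewrite -/c0 -/(mse_rate (lam n) n N) in h.
  have h' := le_trans h (ler_wpM2l c00 rn).
  apply: le_trans (ler_wpM2l _ h') _; first exact: sqr_ge0.
  rewrite le_eqVlt; apply/orP; left; apply/eqP.
  by field; rewrite !gt_eqF.
- exact: cvg_cst.
- apply/fine_cvgP; split; first exact: nearW.
  rewrite -[X in _ --> X](mulr0 (c0 * B)); apply: cvgM; first exact: cvg_cst.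
  have M0 : (Mn n)^-1 @[n --> \oo] --> (0 : R).
    by apply/gtr0_cvgV0 => //; exact: (cvgry_gt Mnoo).
  by rewrite -[X in _ --> X](mulr0 0); under eq_fun do rewrite expr2; exact: cvgM.
Unshelve. all: by end_near.
Qed.

End contraction_criterion.

(** * Contraction rates *)

Section rates.
Context {R : realType}.
Implicit Types x y t s g c L : R.

Lemma powR_sqr x y : (x `^ y) ^+ 2 = x `^ (2 * y).
Proof. by rewrite -(powR_mulrn _ (powR_ge0 _ _)) -powRrM mulrC. Qed.

(** Write [expR (c * x)] as the [g]-th power of [expR (x / (g / c))] and use that [expR y] exceeds
    [y]. *)
Lemma expR_le_powR g c : 0 < g -> 0 < c ->
  exists2 B, 0 < B & forall x, 0 < x -> expR (- (c * x)) <= B * x `^ (- g).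
Proof.
move=> g0 c0; have gc : 0 < g / c by exact: divr_gt0.
exists ((g / c) `^ g) => [|x x0]; first exact: powR_gt0.
rewrite powRN ler_pdivlMr ?powR_gt0// expRN mulrC ler_pdivrMr ?expR_gt0//.
have -> : expR (c * x) = (expR (x / (g / c))) `^ g.
  by rewrite -expRM; congr expR; field; rewrite !gt_eqF.
rewrite -powRM ?expR_ge0 ?(ltW gc)// ge0_ler_powR ?(ltW g0)// ?nnegrE ?(ltW x0)//.
  by rewrite mulr_ge0 ?expR_ge0// ltW.
rewrite mulrC -ler_pdivrMr//; apply: le_trans (expR_ge1Dx _).
by rewrite lerDr.
Qed.

(** A discrete integral comparison: with [x = k + 1], [ln k <= ln x - 1/x], hence [k^(-t) >= x^(-t)
    exp(t/x) >= x^(-t) (1 + t/x)]. Summing over [k] telescopes. *)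
Lemma powR_step_le t k : 0 < t -> (1 <= k)%N ->
  k.+1%:R `^ (- 1 - t) <= t^-1 * (k%:R `^ (- t) - k.+1%:R `^ (- t)).
Proof.
move=> t0 k1; rewrite ler_pdivlMl//.
set x : R := k.+1%:R; have x0 : 0 < x by rewrite ltr0n.
have kR : 0 < k%:R :> R by rewrite ltr0n.
have xV : 0 < x^-1 by rewrite invr_gt0.
have e z : 0 < z -> z `^ (- t) = expR (- t * ln z) by move=> z0; rewrite /powR gt_eqF.
have -> : x `^ (- 1 - t) = x^-1 * x `^ (- t).
  by rewrite powRD ?(gt_eqF x0) ?implybT// powR_inv1// ltW.
have lnk : ln (k%:R : R) <= ln x - x^-1.
  have -> : k%:R = x * (1 + - x^-1) :> R.
    by rewrite mulrDr mulr1 mulrN divff ?gt_eqF// /x -natr1 addrK.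
  have x1 : 0 < 1 + - x^-1.
    rewrite subr_gt0 invf_lt1// /x ltr1n ltnS//.
  by rewrite lnM ?posrE// lerD2l le_ln1Dx// -subr_gt0 opprK addrC.
have : x `^ (- t) * (1 + t / x) <= k%:R `^ (- t).
  rewrite !e//; apply: (@le_trans _ _ (expR (- t * ln x) * expR (t / x))).
    by rewrite ler_pM2l ?expR_gt0// expR_ge1Dx.
  rewrite -expRD ler_expR !mulNr.
  have := ler_wpM2l (ltW t0) lnk; rewrite mulrBr.
  by move: (t * ln x) (t / x) (t * ln _) => A B D; lra.
move=> h; rewrite lerBrDl; apply: le_trans h.
by rewrite mulrDr mulr1 lerD2l [leLHS]mulrA [leLHS]mulrC lexx.
Qed.

Lemma sum_powR_tail_le t N n : 0 < t -> (1 <= N)%N ->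
  \sum_(N.+1 <= k < n) k%:R `^ (- 1 - t) <= t^-1 * N%:R `^ (- t).
Proof.
move=> t0 N1; have tV : 0 <= t^-1 by rewrite invr_ge0 ltW.
have [nN|Nn] := leqP n N.+1; first by rewrite big_geq// mulr_ge0 ?powR_ge0.
suff H m : \sum_(N.+1 <= k < (N + m).+1) k%:R `^ (- 1 - t) <=
    t^-1 * (N%:R `^ (- t) - (N + m)%:R `^ (- t)).
  have -> : n = (N + (n - N.+1)).+1 by lia.
  apply: le_trans (H _) _; rewrite ler_wpM2l// gerBl powR_ge0//.
elim: m => [|m IH]; first by rewrite addn0 big_geq// subrr mulr0.
rewrite addnS big_nat_recr/=; last by rewrite ltnS leq_addr.
have := @powR_step_le t (N + m) t0 (leq_trans N1 (leq_addr _ _)); lra.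
Qed.

Lemma trunc_root L c s : 0 < c -> 1 <= s -> c <= L ->
  exists N, [/\ (1 <= N)%N, N%:R `^ s <= L / c & (L / c) `^ s^-1 <= 2 * N%:R].
Proof.
move=> c0 s1 cL; have s0 : 0 < s by exact: lt_le_trans s1.
have Lc : 1 <= L / c by rewrite ler_pdivlMr// mul1r.
have Lc0 : 0 < L / c by exact: lt_le_trans Lc.
set X := (L / c) `^ s^-1.
have X1 : 1 <= X by rewrite -(powRr0 (L / c)) ler_powR// invr_ge0 ltW.
have X0 : 0 <= X by exact: le_trans X1.
have /andP[h1 h2] := truncn_itv X0.
have N1 : (1 <= Num.truncn X)%N by rewrite truncn_gt0.
exists (Num.truncn X); split => //.
- have -> : L / c = X `^ s by rewrite -powRrM mulVf ?gt_eqF// powRr1// ltW.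
  by rewrite ge0_ler_powR ?nnegrE// ltW.
- apply: le_trans (ltW h2) _; rewrite -natr1 mulrDl mul1r lerD2l.
  by rewrite ler1n.
Qed.

Lemma natr_powRN_le L c s g N : 0 < c -> 0 < L -> 0 <= g -> (1 <= N)%N ->
  (L / c) `^ s^-1 <= 2 * N%:R ->
  N%:R `^ (- g) <= 2 `^ g * c `^ (g / s) * L `^ (- (g / s)).
Proof.
move=> c0 L0 g0 N1 XN; have NR : 0 < N%:R :> R by rewrite ltr0n.
have Lc0 : 0 < L / c by exact: divr_gt0.
have h : (L / c) `^ (s^-1 * g) <= (2 * N%:R) `^ g.
  by rewrite powRrM ge0_ler_powR// nnegrE ?powR_ge0// mulr_ge0.
have -> : 2 `^ g * c `^ (g / s) * L `^ (- (g / s)) = 2 `^ g / (L / c) `^ (s^-1 * g).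
  rewrite -mulrA; congr *%R; rewrite -powRN [s^-1 * g]mulrC powRM ?invr_ge0 ?(ltW c0) ?(ltW L0)//.
  by rewrite -[c^-1](powR_inv1 (ltW c0)) -powRrM mulN1r opprK [LHS]mulrC.
rewrite powRN -[leLHS]mul1r ler_pdivlMr ?powR_gt0// mul1r.
by rewrite ler_pdivrMl ?powR_gt0// [leRHS]mulrC -powRM// ltW.
Qed.

Variables (a : nat -> R) (p s beta c1 : R).
Hypotheses (p0 : 0 < p) (s1 : 1 <= s) (b0 : 0 < beta) (c10 : 0 < c1)
  (a_lb : forall k, (1 <= k)%N -> c1 * expR (- p * k%:R `^ s) <= a k).

Let s0 : 0 < s. Proof. exact: lt_le_trans s1. Qed.

Lemma sqr_eigenvalue_lb N x : (1 <= N)%N -> 2 * p * N%:R `^ s <= x ->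
  c1 ^+ 2 * expR (- x) <= a N ^+ 2.
Proof.
move=> N1 Nx; apply: (@le_trans _ _ ((c1 * expR (- p * N%:R `^ s)) ^+ 2)).
  rewrite exprMn ler_pM2l ?exprn_gt0// -expRM_natl ler_expR; lra.
rewrite lerXn2r ?nnegrE ?a_lb ?mulr_ge0 ?expR_ge0 ?(ltW c10)//.
by rewrite (le_trans _ (a_lb N1))// mulr_ge0 ?expR_ge0 ?(ltW c10).
Qed.

Lemma natr_powRN_ln n y : (1 <= n)%N -> n%:R `^ (- y) = expR (- (y * ln n%:R)) :> R.
Proof. by move=> n1; rewrite /powR gt_eqF ?ltr0n// mulNr. Qed.

Lemma polynomial_prior_rate alpha : 0 < alpha ->
  exists B L0, forall n rho, (2 <= n)%N -> 0 < rho -> L0 <= ln (rho ^+ 2 * n%:R) ->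
    exists2 N, (1 <= N)%N &
      mse_rate a beta (fun k => rho ^+ 2 * k%:R `^ (- 1 - 2 * alpha)) n N <=
      B * Num.max (ln (rho ^+ 2 * n%:R) `^ (- beta / s))
            (rho * ln (rho ^+ 2 * n%:R) `^ (- alpha / s)) ^+ 2.
Proof.
move=> al0.
have hb : 0 < 2 * beta / s by rewrite !mulr_gt0 ?invr_gt0.
have ha : 0 < 2 * alpha / s by rewrite !mulr_gt0 ?invr_gt0.
have h1 : 0 < (1 + 2 * alpha) / s by rewrite mulr_gt0 ?invr_gt0// addr_gt0// mulr_gt0.
have half : 0 < 2^-1 :> R by rewrite invr_gt0.
have [B1 B10 HB1] := expR_le_powR ha half.
have [B3 B30 HB3] := expR_le_powR h1 p0.
have [B4 B40 HB4] := expR_le_powR hb half.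
have h5 : 0 < 2 * beta / 3 by rewrite !mulr_gt0 ?invr_gt0.
have [B5 B50 HB5] := expR_le_powR hb h5.
have h6 : 0 < 2 / 3 :> R by rewrite mulr_gt0 ?invr_gt0.
have [B6 B60 HB6] := expR_le_powR ha h6.
pose b2 := 2 `^ (2 * alpha) * (4 * p) `^ (2 * alpha / s).
pose b4 := 2 `^ (2 * beta) * (4 * p) `^ (2 * beta / s).
have b20 : 0 <= b2 by rewrite mulr_ge0 ?powR_ge0.
have b40 : 0 <= b4 by rewrite mulr_ge0 ?powR_ge0.
exists (c1 ^- 2 * B1 + (2 * alpha)^-1 * b2 + (B3 / c1 ^+ 2) ^+ 2 * B4 + b4 + (B5 + B6)).
(* [4 * p <= L] guarantees [N >= 1]. *)
exists (Num.max 1 (4 * p)) => n rho n2 rho0.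
set L := ln _; rewrite ge_max => /andP[L1 Lp].
have L0 : 0 < L by exact: lt_le_trans L1.
have p40 : 0 < 4 * p by rewrite mulr_gt0.
have nR : 0 < n%:R :> R by rewrite ltr0n ltnW.
have T0 : 0 < rho ^+ 2 * n%:R by rewrite mulr_gt0 ?exprn_gt0.
have TL : expR L = rho ^+ 2 * n%:R by rewrite lnK ?posrE.
have [N [N1 NL LN]] := trunc_root p40 s1 Lp.
exists N => //.
have NR : 0 < N%:R :> R by rewrite ltr0n.
have pN : 4 * p * N%:R `^ s <= L by rewrite mulrC -ler_pdivlMr.
set e := Num.max _ _.
have e0 : 0 <= e by rewrite le_max powR_ge0.
have E1 : L `^ (- (2 * beta / s)) <= e ^+ 2.
  apply: (@le_trans _ _ ((L `^ (- beta / s)) ^+ 2)).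
    by rewrite powR_sqr !mulNr mulrN mulrA.
  by rewrite lerXn2r ?nnegrE ?powR_ge0// le_max lexx.
have E2 : rho ^+ 2 * L `^ (- (2 * alpha / s)) <= e ^+ 2.
  apply: (@le_trans _ _ ((rho * L `^ (- alpha / s)) ^+ 2)).
    by rewrite exprMn powR_sqr !mulNr mulrN mulrA.
  by rewrite lerXn2r ?nnegrE ?mulr_ge0 ?powR_ge0 ?(ltW rho0)// le_max lexx orbT.
have aN := @sqr_eigenvalue_lb N (L / 2) N1.
have {}aN : c1 ^+ 2 * expR (- (L / 2)) <= a N ^+ 2 by apply: aN; lra.
(* Since [1 / n = rho^2 exp(-L)], the variance is of order [rho^2 exp(-L/2)] and is absorbed by the
   second component of the rate. *)
have t1 : (n%:R * a N ^+ 2)^-1 <= c1 ^- 2 * B1 * e ^+ 2.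
  apply: (@le_trans _ _ (c1 ^- 2 * (rho ^+ 2 * expR (- (2^-1 * L))))); last first.
    rewrite -mulrA ler_pM2l ?invr_gt0 ?exprn_gt0//.
    apply: le_trans (ler_wpM2l (ltW B10) E2); rewrite mulrCA ler_pM2l ?exprn_gt0//.
    exact: HB1.
  have -> : c1 ^- 2 * (rho ^+ 2 * expR (- (2^-1 * L))) =
      (n%:R * (c1 ^+ 2 * expR (- (L / 2))))^-1.
    have -> : expR (- (2^-1 * L)) = expR (- (L / 2)) by rewrite mulrC.
    have -> : expR (- (L / 2)) = (expR (L / 2))^-1 by rewrite expRN.
    have eL : expR (L / 2) ^+ 2 = rho ^+ 2 * n%:R.
      by rewrite -TL -expRM_natl; congr expR; field.
    have nE : n%:R = expR (L / 2) ^+ 2 / rho ^+ 2 :> R.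
      by rewrite eL mulrC mulKf// gt_eqF// exprn_gt0.
    rewrite nE; field; rewrite !gt_eqF ?expR_gt0//.
  rewrite lef_pV2 ?posrE; last 2 first.
    by rewrite mulr_gt0// (lt_le_trans _ aN)// mulr_gt0 ?exprn_gt0 ?expR_gt0.
    by rewrite !mulr_gt0 ?exprn_gt0 ?expR_gt0.
  by rewrite ler_pM2l.
have t2 : \sum_(N.+1 <= k < n) rho ^+ 2 * k%:R `^ (- 1 - 2 * alpha) <=
    (2 * alpha)^-1 * b2 * e ^+ 2.
  rewrite -mulr_sumr.
  have a20 : 0 < 2 * alpha by rewrite mulr_gt0.
  have := @sum_powR_tail_le (2 * alpha) N n a20 N1.
  have := natr_powRN_le p40 L0 (ltW a20) N1 LN; rewrite -/b2 => u1 u2.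
  have {}u2 := le_trans u2 (ler_wpM2l (ltW (_ : 0 < (2 * alpha)^-1)) u1).
  apply: le_trans (ler_wpM2l (sqr_ge0 rho) (u2 _)) _; first by rewrite invr_gt0.
  rewrite mulrCA -mulrA ler_pM2l ?invr_gt0// mulrCA ler_wpM2l//.
(* The power of [N] is at least [exp(-p N^s) / B3 >= exp(-L/4) / B3], so the exponents
   [L - L/2 - L/4] leave [L / 4]. *)
have t3 : (n%:R * a N ^+ 2 * (rho ^+ 2 * N%:R `^ (- 1 - 2 * alpha))) ^- 2 <=
    (B3 / c1 ^+ 2) ^+ 2 * B4 * e ^+ 2.
  have cB : 0 < c1 ^+ 2 / B3 by rewrite divr_gt0 ?exprn_gt0.
  have lb : c1 ^+ 2 / B3 * expR (L / 4) <=
      n%:R * a N ^+ 2 * (rho ^+ 2 * N%:R `^ (- 1 - 2 * alpha)).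
    have -> : n%:R * a N ^+ 2 * (rho ^+ 2 * N%:R `^ (- 1 - 2 * alpha)) =
       expR L * (a N ^+ 2 * N%:R `^ (- 1 - 2 * alpha)) by rewrite TL; ring.
    have := HB3 (N%:R `^ s) (powR_gt0 _ NR); rewrite -powRrM.
    have -> : s * - ((1 + 2 * alpha) / s) = - 1 - 2 * alpha by field; rewrite gt_eqF.
    rewrite -ler_pdivrMl// [leLHS]mulrC => u.
    apply: (@le_trans _ _ (expR L * ((c1 ^+ 2 * expR (- (L / 2))) * (expR (- (p * N%:R `^ s)) / B3)))).
      have -> : expR L * ((c1 ^+ 2 * expR (- (L / 2))) * (expR (- (p * N%:R `^ s)) / B3)) =
        c1 ^+ 2 / B3 * (expR L * expR (- (L / 2)) * expR (- (p * N%:R `^ s))) by ring.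
      rewrite ler_pM2l// -!expRD ler_expR; lra.
    rewrite ler_pM2l ?expR_gt0// ler_pM ?mulr_ge0 ?exprn_ge0 ?expR_ge0 ?invr_ge0 ?(ltW c10) ?(ltW B30)//.
  have lb0 : 0 < c1 ^+ 2 / B3 * expR (L / 4) by rewrite mulr_gt0 ?expR_gt0.
  apply: (@le_trans _ _ ((c1 ^+ 2 / B3 * expR (L / 4)) ^- 2)).
    rewrite lef_pV2 ?posrE ?exprn_gt0 ?(lt_le_trans lb0)//.
    by rewrite lerXn2r ?nnegrE ?(ltW lb0) ?(le_trans (ltW lb0)).
  rewrite exprMn invfM -exprVn invf_div -mulrA ler_wpM2l ?sqr_ge0//.
  apply: le_trans (ler_wpM2l (ltW B40) E1); apply: le_trans (HB4 _ L0).
  rewrite -expRM_natl -expRN ler_expR; lra.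
have b20' : 0 <= 2 * beta by rewrite mulr_ge0 ?(ltW b0).
have t4 : N%:R `^ (- (2 * beta)) <= b4 * e ^+ 2.
  by apply: le_trans (natr_powRN_le p40 L0 b20' N1 LN) _; rewrite ler_wpM2l.
have t5 : n%:R `^ (- (2 * beta)) <= (B5 + B6) * e ^+ 2.
  have lnL : L = 2 * ln rho + ln n%:R.
    rewrite /L lnM ?posrE ?exprn_gt0// lnXn// mulr_natl//.
  (* [rho] may grow faster than [n]. If [ln rho <= ln n], then [L <= 3 ln n] and the first component
     suffices. Otherwise [L <= 3 ln rho], so [rho^2 >= exp(2L/3)] and the second component is
     bounded below by a constant. *)
  rewrite [leRHS]mulrDl; have [rn|nr] := leP (ln rho) (ln n%:R).
    rewrite -[leLHS]addr0 lerD ?mulr_ge0 ?sqr_ge0 ?(ltW B60)//.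
    apply: le_trans (ler_wpM2l (ltW B50) E1); apply: le_trans (HB5 _ L0).
    rewrite natr_powRN_ln ?(ltnW n2)// ler_expR lnL.
    have := ler_wpM2l b20' rn; lra.
  rewrite -[leLHS]add0r lerD ?mulr_ge0 ?sqr_ge0 ?(ltW B50)//.
  apply: (@le_trans _ _ 1).
    rewrite natr_powRN_ln ?(ltnW n2)// -[leRHS]expR0 ler_expR oppr_le0.
    by rewrite mulr_ge0// ln_ge0// ler1n ltnW.
  apply: le_trans (ler_wpM2l (ltW B60) E2); rewrite mulrCA.
  have := ler_wpM2l (sqr_ge0 rho) (HB6 _ L0); apply: le_trans.
  have -> : rho ^+ 2 = expR (2 * ln rho) by rewrite expRM_natl lnK ?posrE.
  rewrite -expRD -[leLHS]expR0 ler_expR lnL; lra.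
by apply: le_trans (lerD (lerD (lerD (lerD t1 t2) t3) t4) t5) _; rewrite -!mulrDl.
Qed.

End rates.

(** * Exponentially decaying prior variances *)

Section exponential_prior.
Context {R : realType}.
Variables (a : nat -> R) (p s beta c1 : R).
Hypotheses (p0 : 0 < p) (s1 : 1 <= s) (b0 : 0 < beta) (c10 : 0 < c1)
  (a_lb : forall k, (1 <= k)%N -> c1 * expR (- p * k%:R `^ s) <= a k).

Let s0 : 0 < s. Proof. exact: lt_le_trans s1. Qed.

Lemma sum_expR_powR_tail_le alpha N n : 0 < alpha -> (1 <= N)%N ->
  \sum_(N.+1 <= k < n) expR (- alpha * k%:R `^ s) <=
  expR (- alpha * N%:R `^ s) * (1 - expR (- alpha))^-1.
Proof.
move=> al0 N1; have q01 : 0 <= expR (- alpha) < 1.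
  by rewrite expR_ge0 expR_lt1 oppr_lt0.
have /andP[q0 q1] := q01.
apply: (@le_trans _ _ (\sum_(N.+1 <= k < n)
    expR (- alpha * N%:R `^ s) * expR (- alpha) ^+ (k - N.+1))).
  rewrite !big_nat ler_sum// => k /andP[Nk _].
  have := @powR_nat_ge_add R s N k s1; rewrite N1 (ltnW Nk) => /(_ isT) h.
  apply: (@le_trans _ _ (expR (- alpha * N%:R `^ s) * expR (- alpha) ^+ (k - N))).
    rewrite -expRM_natl -expRD ler_expR.
    have := ler_wpM2l (ltW al0) h; lra.
  by rewrite ler_pM2l ?expR_gt0// -(subnSK Nk) exprS ler_piMl ?exprn_ge0// ltW.
by rewrite -mulr_sumr ler_pM2l ?expR_gt0// sum_geometric_above.
Qed.

Lemma exponential_prior_rate alpha : 0 < alpha ->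
  exists B L0, forall n, (2 <= n)%N -> L0 <= ln (n%:R : R) ->
    exists2 N, (1 <= N)%N &
      mse_rate a beta (fun k => expR (- alpha * k%:R `^ s)) n N <=
      B * (ln n%:R `^ (- beta / s)) ^+ 2.
Proof.
move=> al0.
have hb : 0 < 2 * beta / s by rewrite !mulr_gt0 ?invr_gt0.
have half : 0 < 2^-1 :> R by rewrite invr_gt0.
have [B4 B40 HB4] := expR_le_powR hb half.
have b20 : 0 < 2 * beta by rewrite mulr_gt0.
have [B5 B50 HB5] := expR_le_powR hb b20.
(* Half of [L = ln n] must absorb both [a N ^+ 2], costing [2 * p * N%:R]^
   s[, and the prior variance, costing]alpha * N%:R [^ s]. *)
have [c cE] : exists c, c = 2 * (2 * p + alpha) by exists (2 * (2 * p + alpha)).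
have c0 : 0 < c by rewrite cE mulr_gt0// addr_gt0// mulr_gt0.
(* Rounding gives [N^s >= L / (c 2^s)], so the prior variance at [N] is at most
   [exp(-L alpha / (c 2^s))]. *)
have h6 : 0 < alpha / (c * 2 `^ s).
  by rewrite divr_gt0// mulr_gt0// powR_gt0.
have [B6 B60 HB6] := expR_le_powR hb h6.
pose b4 := 2 `^ (2 * beta) * c `^ (2 * beta / s).
have b40 : 0 <= b4 by rewrite mulr_ge0 ?powR_ge0.
exists (c1 ^- 2 * B4 + (1 - expR (- alpha))^-1 * B6 + (c1 ^- 2) ^+ 2 * B4 + b4 + B5).
exists (Num.max 1 c) => n n2.
set L := ln _; rewrite ge_max => /andP[L1 Lc].
have L0 : 0 < L by exact: lt_le_trans L1.
have nR : 0 < n%:R :> R by rewrite ltr0n ltnW.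
have nL : n%:R = expR L by rewrite lnK ?posrE.
have [N [N1 NL LN]] := trunc_root c0 s1 Lc.
exists N => //.
have NR : 0 < N%:R :> R by rewrite ltr0n.
have cN : c * N%:R `^ s <= L by rewrite mulrC -ler_pdivlMr.
have Ns0 : 0 <= N%:R `^ s by exact: powR_ge0.
have E1 : (L `^ (- beta / s)) ^+ 2 = L `^ (- (2 * beta / s)).
  by rewrite powR_sqr !mulNr mulrN mulrA.
rewrite E1.
have c1V : 0 < c1 ^- 2 by rewrite invr_gt0 exprn_gt0.
have aN := sqr_eigenvalue_lb c10 a_lb N1 (lexx _).
(* This bound serves the bias directly and the variance too, because the prior variance is at most
   1. *)
have aNn : c1 ^+ 2 * expR (L / 2) <= n%:R * a N ^+ 2 * expR (- alpha * N%:R `^ s).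
  apply: (@le_trans _ _ (expR L * (c1 ^+ 2 * expR (- (2 * p * N%:R `^ s))) *
     expR (- alpha * N%:R `^ s))); last first.
    by rewrite nL ler_pM2r ?expR_gt0// ler_pM2l ?expR_gt0.
  rewrite [expR L * _]mulrCA -[leRHS]mulrA ler_pM2l ?exprn_gt0// -!expRD ler_expR.
  rewrite cE in cN; lra.
have lb0 : 0 < c1 ^+ 2 * expR (L / 2) by rewrite mulr_gt0 ?exprn_gt0 ?expR_gt0.
have eN1 : expR (- alpha * N%:R `^ s) <= 1.
  by rewrite -[leRHS]expR0 ler_expR mulNr oppr_le0 mulr_ge0// ltW.
have aN2 : 0 < n%:R * a N ^+ 2.
  by rewrite mulr_gt0// (lt_le_trans _ aN)// mulr_gt0 ?exprn_gt0 ?expR_gt0.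
have inv1 : (c1 ^+ 2 * expR (L / 2))^-1 = c1 ^- 2 * expR (- (2^-1 * L)).
  by rewrite invfM -expRN [L / 2]mulrC.
have t1 : (n%:R * a N ^+ 2)^-1 <= c1 ^- 2 * B4 * L `^ (- (2 * beta / s)).
  apply: (@le_trans _ _ ((c1 ^+ 2 * expR (L / 2))^-1)).
    by rewrite lef_pV2 ?posrE//; apply: le_trans aNn _; rewrite ler_piMr// ltW.
  by rewrite inv1 -mulrA ler_pM2l// HB4.
have q1 : 0 < 1 - expR (- alpha) by rewrite subr_gt0 expR_lt1 oppr_lt0.
have t2 : \sum_(N.+1 <= k < n) expR (- alpha * k%:R `^ s) <=
    (1 - expR (- alpha))^-1 * B6 * L `^ (- (2 * beta / s)).
  apply: le_trans (sum_expR_powR_tail_le n al0 N1) _.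
  rewrite mulrC -mulrA ler_pM2l ?invr_gt0//; apply: le_trans (HB6 _ L0).
  rewrite ler_expR mulNr lerN2 -!mulrA ler_pM2l//.
  rewrite ler_pdivrMl ?mulr_gt0 ?powR_gt0// -mulrA -ler_pdivrMl// [leLHS]mulrC.
  have -> : L / c = ((L / c) `^ s^-1) `^ s.
    by rewrite -powRrM mulVf ?gt_eqF// powRr1// divr_ge0 ?ltW.
  rewrite -powRM// ge0_ler_powR ?nnegrE ?powR_ge0 ?mulr_ge0// ltW//.
have t3 : (n%:R * a N ^+ 2 * expR (- alpha * N%:R `^ s)) ^- 2 <=
    (c1 ^- 2) ^+ 2 * B4 * L `^ (- (2 * beta / s)).
  apply: (@le_trans _ _ ((c1 ^+ 2 * expR (L / 2)) ^- 2)).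
    rewrite lef_pV2 ?posrE ?exprn_gt0 ?(lt_le_trans lb0 aNn)//.
    by rewrite lerXn2r ?nnegrE ?(ltW lb0) ?(le_trans (ltW lb0) aNn).
  rewrite -exprVn inv1 exprMn -mulrA ler_pM2l ?exprn_gt0//.
  apply: le_trans (HB4 _ L0); rewrite -expRM_natl ler_expR; lra.
have t4 : N%:R `^ (- (2 * beta)) <= b4 * L `^ (- (2 * beta / s)).
  exact: natr_powRN_le c0 L0 (ltW b20) N1 LN.
have t5 : n%:R `^ (- (2 * beta)) <= B5 * L `^ (- (2 * beta / s)).
  by rewrite natr_powRN_ln ?(ltnW n2)// HB5.
by apply: le_trans (lerD (lerD (lerD (lerD t1 t2) t3) t4) t5) _; rewrite -!mulrDl.
Qed.

End exponential_prior.

(** * Assembly of the four contraction statements *)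

Lemma ln_nat_large {R : realType} (A : R) : \forall n \near \oo, A <= ln (n%:R : R).
Proof.
exists (Num.truncn (expR A)).+1 => // n /= An.
have eA : expR A < n%:R.
  by apply: lt_le_trans (truncnS_gt _) _; rewrite ler_nat.
have n0 : 0 < n%:R :> R by apply: lt_trans eA; exact: expR_gt0.
by rewrite -ler_expR lnK ?posrE// ltW.
Qed.

Lemma le_powRN {R : realType} (x y g : R) : 0 < x -> x <= y -> 0 <= g ->
  y `^ (- g) <= x `^ (- g).
Proof.
move=> x0 xy g0; have y0 := lt_le_trans x0 xy.
rewrite !powRN lef_pV2 ?posrE ?powR_gt0// ge0_ler_powR// ?nnegrE ltW//.
Qed.

Unset Implicit Arguments. Set Strict Implicit. Set Printing Implicit Defensive.

Theorem mainTheorem3 (R : realType)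
  (a : nat -> R) (psi : nat -> R -> R) (Mpsi : R) (p s beta : R)
  (a_pos : forall k : nat, (1 <= k)%N -> 0 < a k)
  (design : design_assumption psi Mpsi)
  (hp : 0 < p) (hs : 1 <= s) (hbeta : 0 < beta)
  (a_asymp : exists c1 c2 : R, 0 < c1 /\ 0 < c2 /\
     exists k0 : nat, forall k : nat, (k0 <= k)%N ->
       c1 * expR (- p * k%:R `^ s) <= a k <= c2 * expR (- p * k%:R `^ s))
  (A_def : forall f : nat -> R, (sobsq beta f < +oo)%E ->
     forall x : R, 0 <= x <= 1 ->
       cvgn (fun N => \sum_(1 <= k < N) a k * f k * psi k x)) :
  forall alpha K : R, 0 < alpha -> 0 < K ->
  (* general rho_n *)
  (forall rho : nat -> R, (forall n, 0 < rho n) ->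
     (fun n => rho n ^+ 2 * n%:R) @ \oo --> +oo ->
     contracts a psi (fun n k => rho n ^+ 2 * k%:R `^ (- 1 - 2 * alpha)) beta K
       (fun n => Num.max (ln (rho n ^+ 2 * n%:R) `^ (- beta / s))
                         (rho n * ln (rho n ^+ 2 * n%:R) `^ (- alpha / s))))
  (* (i) rho_n = 1 *)
  /\ contracts a psi (fun n k => k%:R `^ (- 1 - 2 * alpha)) beta K
       (fun n => ln (n%:R : R) `^ (- Num.min alpha beta / s))
  (* (ii) n^{-1/2+delta} <~ rho_n <~ (log n)^{(alpha-beta)/s} *)
  /\ (forall (rho : nat -> R) (delta : R), (forall n, 0 < rho n) -> 0 < delta ->
       (exists C : R, 0 < C /\
          \forall n \near \oo, (n%:R : R) `^ (- 2^-1 + delta) <= C * rho n) ->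
       (exists C : R, 0 < C /\
          \forall n \near \oo, rho n <= C * ln (n%:R : R) `^ ((alpha - beta) / s)) ->
       contracts a psi (fun n k => rho n ^+ 2 * k%:R `^ (- 1 - 2 * alpha)) beta K
         (fun n => ln (n%:R : R) `^ (- beta / s)))
  (* exponential prior lambda_k = exp(-alpha k^s) *)
  /\ contracts a psi (fun n k => expR (- alpha * k%:R `^ s)) beta K
       (fun n => ln (n%:R : R) `^ (- beta / s)).

Proof.
move=> alpha K alpha0 K0; have s0 : 0 < s by exact: lt_le_trans hs.
have [c1 [c2 [c10 c20 ak]]] := asymp_uniform a_pos a_asymp.
have ratio := asymp_ratio (ltW hp) hs c10 c20 ak.
have C0 : 0 < c2 / c1 by exact: divr_gt0.
have q01 : 0 <= expR (- p) < 1 by rewrite expR_ge0 expR_lt1 oppr_lt0.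
have a_lb k : (1 <= k)%N -> c1 * expR (- p * k%:R `^ s) <= a k.
  by move=> /ak/andP[].
have criterion := contracts_of_mse_rate a_pos design (ltW hbeta) (ltW K0) C0 q01 ratio A_def.
(* All three polynomial-prior claims follow from this form, where [eps] need only dominate the
   maximum up to a constant. *)
have poly (rho eps : nat -> R) (B : R) : (forall n, 0 < rho n) ->
    (\forall n \near \oo, 0 < eps n) ->
    (forall A, \forall n \near \oo, A <= ln (rho n ^+ 2 * n%:R)) ->
    (\forall n \near \oo, Num.max (ln (rho n ^+ 2 * n%:R) `^ (- beta / s))
       (rho n * ln (rho n ^+ 2 * n%:R) `^ (- alpha / s)) <= B * eps n) ->
    contracts a psi (fun n k => rho n ^+ 2 * k%:R `^ (- 1 - 2 * alpha)) beta K eps.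
  move=> rho0 eps0 Llarge epsB.
  have [B0 [L0 HB]] := polynomial_prior_rate hp hs hbeta c10 a_lb alpha0.
  apply: (criterion _ _ (`|B0| * B ^+ 2)) => //.
  - by move=> n k k1; rewrite mulr_gt0 ?exprn_gt0 ?powR_gt0 ?ltr0n.
  - move=> n k j /andP[k1 kj]; rewrite ler_pM2l ?exprn_gt0// -opprD.
    by rewrite le_powRN ?ltr0n ?ler_nat// addr_ge0// mulr_ge0// ltW.
  near=> n.
  have [||N N1 HN] := HB n (rho n) _ (rho0 n).
  - by near: n; exists 2%N.
  - by near: n.
  exists N => //; apply: le_trans HN _.
  apply: le_trans (ler_wpM2r (sqr_ge0 _) (ler_norm _)) _.
  rewrite -[leRHS]mulrA ler_wpM2l// -exprMn lerXn2r ?nnegrE ?le_max ?powR_ge0//.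
    apply: (@le_trans _ _ (Num.max (ln (rho n ^+ 2 * n%:R) `^ (- beta / s))
       (rho n * ln (rho n ^+ 2 * n%:R) `^ (- alpha / s)))); last by near: n.
    by rewrite le_max powR_ge0.
  by near: n.
split; [|split; [|split]].
- move=> rho rho0 rhoy.
  have Llarge A : \forall n \near \oo, A <= ln (rho n ^+ 2 * n%:R).
    near=> n; have h : expR A <= rho n ^+ 2 * n%:R.
      by near: n; move/cvgryPge : rhoy; exact.
    by rewrite -ler_expR lnK// posrE (lt_le_trans _ h)// expR_gt0.
  apply: (poly _ _ 1) => //; last by apply: nearW => n; rewrite mul1r.
  near=> n; rewrite lt_max powR_gt0// (@lt_le_trans _ _ 1)//.
  by near: n; exact: Llarge.
- have -> : (fun (n k : nat) => k%:R `^ (- 1 - 2 * alpha) : R) =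
      (fun n k => (fun=> 1) n ^+ 2 * k%:R `^ (- 1 - 2 * alpha)).
    by apply/funext => n; apply/funext => k; rewrite expr1n mul1r.
  apply: (poly (fun=> 1) _ 1) => //.
  + near=> n; rewrite powR_gt0// (@lt_le_trans _ _ 1)//.
    by near: n; exact: ln_nat_large.
  + move=> A; near=> n; rewrite expr1n mul1r; near: n; exact: ln_nat_large.
  + near=> n; rewrite expr1n !mul1r ge_max.
    have l1 : 1 <= ln (n%:R : R) by near: n; exact: ln_nat_large.
    by rewrite !ler_powR// ler_pM2r ?invr_gt0// lerN2 ge_min lexx ?orbT.
- move=> rho delta rho0 delta0 [C1 [C10 rholb]] [C2 [C20 rhoub]].
  (* The lower bound on [rho] gives [ln (rho^2 n) >= 2 delta ln n - 2 ln C1], and half of the main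
     term eventually absorbs the constant. *)
  have Llb : \forall n \near \oo, delta * ln (n%:R : R) <= ln (rho n ^+ 2 * n%:R).
    near=> n.
    have n0 : 0 < n%:R :> R by rewrite ltr0n; near: n; exists 1%N.
    have lnl : 2 * ln C1 / delta <= ln (n%:R : R) by near: n; exact: ln_nat_large.
    have h : (n%:R : R) `^ (- 2^-1 + delta) <= C1 * rho n by near: n.
    rewrite -ler_ln ?posrE ?powR_gt0 ?mulr_gt0// ln_powR lnM ?posrE// in h.
    rewrite ler_pdivrMr// in lnl.
    rewrite lnM ?posrE ?exprn_gt0// lnXn//; lra.
  apply: (poly _ _ (delta `^ (- (beta / s)) + C2 * delta `^ (- (alpha / s)))) => //.
  + near=> n; rewrite powR_gt0// (@lt_le_trans _ _ 1)//.
    by near: n; exact: ln_nat_large.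
  + move=> A; near=> n; apply: (@le_trans _ _ (delta * ln (n%:R : R))); last by near: n.
    by rewrite mulrC -ler_pdivrMr//; near: n; exact: ln_nat_large.
  + near=> n.
    have l1 : 1 <= ln (n%:R : R) by near: n; exact: ln_nat_large.
    have l0 := lt_le_trans ltr01 l1.
    have dl : delta * ln (n%:R : R) <= ln (rho n ^+ 2 * n%:R) by near: n.
    have ru : rho n <= C2 * ln (n%:R : R) `^ ((alpha - beta) / s) by near: n.
    have dl0 : 0 < delta * ln (n%:R : R) by exact: mulr_gt0.
    have bs : 0 <= beta / s by rewrite divr_ge0 ?ltW.
    have als : 0 <= alpha / s by rewrite divr_ge0 ?ltW.
    have h1 := le_powRN dl0 dl bs; have h2 := le_powRN dl0 dl als.
    rewrite (powRM _ (ltW delta0) (ltW l0)) in h1.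
    rewrite (powRM _ (ltW delta0) (ltW l0)) in h2.
    rewrite ge_max !mulNr; apply/andP; split.
      apply: le_trans h1 _; rewrite ler_wpM2r ?powR_ge0// lerDl.
      by rewrite mulr_ge0 ?powR_ge0 ?(ltW C20).
    apply: le_trans (ler_pM _ _ ru h2) _; rewrite ?powR_ge0 ?(ltW (rho0 n))//.
    (* The upper bound on [rho] is calibrated so that the exponents [(alpha - beta) / s] and
       [- alpha / s] add up to [- beta / s]. *)
    have -> : C2 * ln n%:R `^ ((alpha - beta) / s) *
        (delta `^ (- (alpha / s)) * ln n%:R `^ (- (alpha / s))) =
        C2 * delta `^ (- (alpha / s)) * ln (n%:R : R) `^ (- (beta / s)).
      rewrite mulrACA -powRD; last by rewrite (gt_eqF l0) implybT.
      by congr (_ * _ `^ _); rewrite mulrBl; ring.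
    by rewrite ler_wpM2r ?powR_ge0// lerDr powR_ge0.
- have [B0 [L0 HB]] := exponential_prior_rate hp hs hbeta c10 a_lb alpha0.
  apply: (criterion _ _ B0).
  + by move=> n k _; exact: expR_gt0.
  + move=> _ k j /andP[k1 kj]; rewrite ler_expR !mulNr lerN2 ler_pM2l//.
    by rewrite ge0_ler_powR ?nnegrE ?ler_nat// ltW.
  + near=> n; rewrite powR_gt0// (@lt_le_trans _ _ 1)//.
    by near: n; exact: ln_nat_large.
  + near=> n; apply: HB.
      by near: n; exists 2%N.
    by near: n; exact: ln_nat_large.
Unshelve. all: by end_near.
Qed.
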